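(* For any integers $k \geq 2$ and $l \in \{0, \ldots, k-1\}$ there exists an $n_0$ such that for any $n \geq n_0$ with $(k-l) \mid n$, \[ \mathrm{ex}\left(n, C^k_l(n)\right) = \binom{n-1}{k} + \mathrm{ex}\left(n-1, P(k,l)\right). \] Furthermore, any extremal $k$-graph on $n$ vertices (i.e. any $k$-graph on $n$ vertices with $\mathrm{ex}(n, C^k_l(n))$ edges and no $l$-tight Hamiltonian cycle) contains a complete $k$-graph on $n-1$ vertices and a vertex whose link is $P(k,l)$-free.
   Context: A $k$-uniform hypergraph ($k$-graph) $H$ is a pair $(V,E)$ with $E \subseteq \binom{V}{k}$. For a fixed (family of) hypergraph(s) $F$, $\mathrm{ex}(n,F)$ denotes the largest number of edges of a $k$-graph on $n$ vertices (with $k$ the uniformity of $F$) containing no subgraph isomorphic to $F$. For $0 \le l \le k-1$ and $(k-l)\mid n$, an $l$-tight Hamiltonian cycle $C^k_l(n)$ in a $k$-graph on $n$ vertices is a spanning sub-$k$-graph isomorphic to $([n],E)$ with $E = \{\{i(k-l)+1, \ldots, i(k-l)+k\} : 0 \le i < n/(k-l)\}$, addition modulo $n$. For a vertex $v$ of a $k$-graph $H$, the link $H(v)$ is the $(k-1)$-graph on $V\setminus\{v\}$ whose edges are the $(k-1)$-sets $S$ with $S\cup\{v\} \in E(H)$. An $l'$-tight $k'$-uniform $t$-path is a $k'$-graph on $t$ vertices, with $(k'-l') \mid (t-l')$, whose vertices can be ordered $x_1,\ldots,x_t$ so that its edges are exactly $\{x_{i(k'-l')+1}, \ldots, x_{i(k'-l')+k'}\}$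 for $0 \le i < (t-l')/(k'-l')$ (edges are segments of the ordering, consecutive edges meeting in exactly $l'$ vertices). $P(k,l)$ denotes the $(l-1)$-tight $(k-1)$-uniform path on $\lfloor \frac{k}{k-l}\rfloor (k-l) + l - 1$ vertices; it has $\lfloor \frac{k}{k-l}\rfloor$ edges (for $l=0$ it is a single edge of size $k-1$). A $(k-1)$-graph is $P(k,l)$-free if it contains no subgraph isomorphic to $P(k,l)$. *)

(* Defs.v *)
From mathcomp Require Import all_boot.

Set Implicit Arguments.
Unset Strict Implicit.
Unset Printing Implicit Defensive.

(* A hypergraph is given by its edge set [H : {set {set T}}]; the finite type
   [T] is its whole vertex set, isolated vertices included. *)

Definition uniform (T : finType) (k : nat) (H : {set {set T}}) : bool :=
  [forall e in H, #|e| == k].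

(* [H] has a subgraph isomorphic to [F]; the copy is spanning when both vertex
   types have the same cardinality. *)
Definition has_copy (U T : finType) (F : {set {set U}}) (H : {set {set T}})
    : bool :=
  [exists f : {ffun U -> T}, injectiveb f && [forall e in F, f @: e \in H]].

Definition free (U T : finType) (F : {set {set U}}) (H : {set {set T}}) : bool :=
  ~~ has_copy F H.

(* The uniformity [k] is explicit, since [F] does not determine it when it has
   no edges. *)
Definition ex_num (U : finType) (k n : nat) (F : {set {set U}}) : nat :=
  \max_(H : {set {set 'I_n}} | uniform k H && free F H) #|H|.

Definition extremal (U T : finType) (k : nat) (F : {set {set U}})
    (H : {set {set T}}) : Prop :=
  [/\ uniform k H, free F H & #|H| = ex_num k #|T| F].

(* The vertices 1, ..., n are shifted to 0, ..., n-1. *)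
Definition tight_cycle (k l n : nat) : {set {set 'I_n}} :=
  [set [set x : 'I_n | [exists j : 'I_k, x == (i * (k - l) + j) %% n :> nat]]
     | i : 'I_(n %/ (k - l))].

Definition tight_path (k l t : nat) : {set {set 'I_t}} :=
  [set [set x : 'I_t | i * (k - l) <= x < i * (k - l) + k]
     | i : 'I_((t - l) %/ (k - l))].

Definition P_order (k l : nat) : nat := k %/ (k - l) * (k - l) + l - 1.

(* For [l = 0] the truncated [l - 1] is 0 rather than -1; since then
   [P_order k 0 = k - 1], this is still the single edge of size [k - 1]. *)
Definition P (k l : nat) : {set {set 'I_(P_order k l)}} :=
  tight_path (k - 1) (l - 1) (P_order k l).

Definition link (T : finType) (H : {set {set T}}) (v : T)
    : {set {set {x : T | x != v}}} :=
  [set S : {set {x : T | x != v}} | v |: (val @: S) \in H].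

Definition complete_on (T : finType) (k : nat) (H : {set {set T}}) (W : {set T})
    : bool :=
  [forall e : {set T}, (e \subset W) && (#|e| == k) ==> (e \in H)].

(* Main.v *)
(** Let [M] be the set of [k]-sets missing from an extremal candidate [H], so
    that [M] has at most C(n-1,k-1) - ex(n-1,P) elements.  If some link is
    [P]-free then all of [M] contains that vertex and we are done.  Otherwise a
    Hamiltonian cycle exists.  All vertices outside a bounded set of bad ones
    miss only a small fraction of their possible edges, and the lopsided local
    lemma in the space of injections, where the negative correlation comes from
    swapping two values, embeds the cycle, even when it is prescribed on a
    bounded set of positions and every cycle edge meeting this set has few
    completions in [M].  It remains to plant every bad vertex in a short segment
    of the cycle with that boundary condition.  All but one of them have a link
    of positive density, which contains a tight path.  The vertex [v0] of largest
    missing degree is planted with a copy of [P]: the link of [v0] has at least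
    ex(n-1,P) + s edges, where s is the number of missing edges avoiding [v0], and
    only O(s/n) of its edges contain a set violating the boundary condition. *)

Require Import Defs.
From mathcomp Require Import all_boot perm.
From mathcomp Require Import zify.

Set Implicit Arguments.
Unset Strict Implicit.
Unset Printing Implicit Defensive.

(** * Elementary bounds on sums, among them a weighted union bound *)

Lemma leq_sum_cover (I J : finType) (P : pred I) (A : pred J)
    (Q : J -> pred I) (w : I -> nat) :
  (forall x, P x -> exists2 j, A j & Q j x) ->
  \sum_(x | P x) w x <= \sum_(j | A j) \sum_(x | Q j x) w x.
Proof.
move=> cov; rewrite (exchange_big_dep xpredT) //= [leqLHS]big_mkcond.
apply: leq_sum => x _; case: ifP => // /cov[j Aj Qjx].
by rewrite (bigD1 j) ?Aj //= leq_addr.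
Qed.

Lemma leq_sum_bound (I : finType) (P : pred I) (w : I -> nat) (b c : nat) :
  (forall x, P x -> b * w x <= c) -> b * \sum_(x | P x) w x <= #|P| * c.
Proof.
move=> le_bc; rewrite big_distrr /= -sum_nat_const.
exact: leq_sum.
Qed.

Lemma leq_sum_subset (I : finType) (P Q : pred I) (w : I -> nat) :
  (forall x, P x -> Q x) -> \sum_(x | P x) w x <= \sum_(x | Q x) w x.
Proof.
move=> sPQ; rewrite big_mkcond [leqRHS]big_mkcond; apply: leq_sum => x _.
by case: ifP => // /sPQ ->.
Qed.

(** * The lopsided local lemma *)

Definition avoid (Om I : finType) (O : {set Om}) (A : I -> {set Om})
    (S : {set I}) : {set Om} :=
  [set o in O | [forall i in S, o \notin A i]].

Lemma avoidS (Om I : finType) (O : {set Om}) (A : I -> {set Om})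
    (S1 S2 : {set I}) :
  S1 \subset S2 -> avoid O A S2 \subset avoid O A S1.
Proof.
move/subsetP => s12; apply/subsetP => o; rewrite !inE => /andP[-> /forall_inP h].
by apply/forall_inP => i /s12 /h.
Qed.

(* Lovász local lemma, with the independence hypothesis replaced by the
   one-sided bound [indep] (Erdős-Spencer); [w i / Q] bounds the probability of
   [A i]. *)
Lemma lopsided_local_lemma (Om I : finType) (O : {set Om}) (D : {set I})
    (A : I -> {set Om}) (nb : rel I) (w : I -> nat) (Q : nat) :
  (forall i (S : {set I}), i \in D -> S \subset D ->
     (forall j, j \in S -> ~~ nb i j) ->
     Q * #|A i :&: avoid O A S| <= w i * #|avoid O A S|) ->
  (forall i, i \in D -> 4 * (\sum_(j in D | nb i j) w j) <= Q) ->
  (forall i, i \in D -> 2 * w i < Q) ->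
  0 < #|O| -> 0 < #|avoid O A D|.
Proof.
move=> indep sum_le w_lt O_gt0.
(* Conditioned on [avoid O A S], the event [A i] has probability at most [2 * w i / Q]; the
   induction is on the size of [S]. *)
have key: forall N i (S : {set I}), #|S| <= N -> i \in D -> S \subset D ->
    Q * #|A i :&: avoid O A S| <= 2 * w i * #|avoid O A S|.
  elim=> [|N IHN] i S leSN iD sSD.
    apply: leq_trans (indep i S iD sSD _) _.
      by move=> j; move: leSN; rewrite leqn0 cards_eq0 => /eqP ->; rewrite inE.
    by rewrite leq_mul2r leq_pmull ?orbT.
  pose S1 := [set j in S | nb i j]; pose S2 := [set j in S | ~~ nb i j].
  have sS2S: S2 \subset S by apply/subsetP => j; rewrite inE => /andP[].
  have sS2D := subset_trans sS2S sSD.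
  have ind2: Q * #|A i :&: avoid O A S2| <= w i * #|avoid O A S2|.
    by apply: indep => // j; rewrite inE => /andP[].
  have leA: #|A i :&: avoid O A S| <= #|A i :&: avoid O A S2|.
    by apply/subset_leq_card/setIS/avoidS.
  (* Imposing the neighbours [S1] on top of [S2] loses at most half of the outcomes: by induction
     each [A j] takes a share of at most [2 * w j / Q], and these shares sum to at most 1/2. *)
  suff le2: Q * #|avoid O A S2| <= Q * (2 * #|avoid O A S|).
    have Q_gt0 : 0 < Q by move: (w_lt i iD); lia.
    rewrite leq_pmul2l // in le2.
    apply: leq_trans (leq_mul (leqnn Q) leA) (leq_trans ind2 _).
    by rewrite -mulnA mulnCA leq_mul2l le2 orbT.
  have [S1_0|/set0Pn[j0 j0S1]] := eqVneq S1 set0.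
    have -> : S2 = S; last by rewrite leq_mul2l leq_pmull ?orbT.
    apply/setP => j; rewrite inE; case jS: (j \in S) => //=.
    by move/setP/(_ j): S1_0; rewrite !inE jS /= => ->.
  have card2 : #|S2| <= N.
    have: S2 \proper S.
      rewrite properE sS2S /=; apply/subsetPn; exists j0.
        by move: j0S1; rewrite inE => /andP[].
      by move: j0S1; rewrite !inE => /andP[_ ->]; rewrite andbF.
    by move/proper_card => h; rewrite -ltnS (leq_trans h).
  have cov: #|avoid O A S2| <=
      #|avoid O A S| + \sum_(j in S1) #|A j :&: avoid O A S2|.
    have sub: avoid O A S2 \subset
        avoid O A S :|: \bigcup_(j in S1) (A j :&: avoid O A S2).
      apply/subsetP => o oS2; rewrite inE.
      case: (boolP (o \in avoid O A S)) => //= oS; apply/bigcupP.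
      move: (oS2); rewrite inE => /andP[oO /forall_inP h].
      move: oS; rewrite inE oO /= negb_forall_in => /exists_inP[j jS].
      rewrite negbK => oAj; exists j; last by rewrite inE oAj.
      rewrite inE jS /=; apply: contraLR oAj => nbij; apply: h.
      by rewrite inE jS.
    apply: leq_trans (subset_leq_card sub) _.
    rewrite cardsU; apply: leq_trans (leq_subr _ _) _; rewrite leq_add2l.
    rewrite -!sum1_card.
    have -> : \sum_(j in S1) #|A j :&: avoid O A S2| =
        \sum_(j in S1) \sum_(o in A j :&: avoid O A S2) 1.
      by apply: eq_bigr => j _; rewrite sum1_card.
    by apply: leq_sum_cover => o /bigcupP[j jS1 oj]; exists j.
  have sum1 : Q * (\sum_(j in S1) #|A j :&: avoid O A S2|) <=
      2 * (\sum_(j in D | nb i j) w j) * #|avoid O A S2|.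
    rewrite big_distrr /=.
    apply: (@leq_trans (\sum_(j in S1) 2 * w j * #|avoid O A S2|)).
      apply: leq_sum => j; rewrite inE => /andP[jS _].
      by apply: IHN => //; apply: (subsetP sSD).
    rewrite -big_distrl /= leq_mul2r -big_distrr /= leq_mul2l /=.
    rewrite leq_sum_subset ?orbT // => j; rewrite inE => /andP[jS ->].
    by rewrite (subsetP sSD).
  have := sum_le i iD; move: cov sum1; nia.
(* The events are now imposed one at a time; since [2 * w i < Q], no single one exhausts the
   remaining outcomes. *)
have sub : forall N (S : {set I}), #|S| <= N -> S \subset D ->
    0 < #|avoid O A S|.
  elim=> [|N IHN] S leSN sSD.
    move: leSN; rewrite leqn0 cards_eq0 => /eqP ->.
    apply: leq_trans O_gt0 (subset_leq_card _).
    apply/subsetP => o oO; rewrite inE oO /=; apply/forall_inP => i.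
    by rewrite inE.
  have [S0|[i iS]] := set_0Vmem S.
    by apply: IHN => //; rewrite S0 cards0.
  have sS' : S :\ i \subset D by apply: subset_trans (subsetDl _ _) sSD.
  have cS' : #|S :\ i| <= N by move: leSN; rewrite (cardsD1 i S) iS.
  have iD := subsetP sSD i iS.
  have h1 := IHN _ cS' sS'; have h2 := key N i _ cS' iD sS'.
  have h3 := w_lt i iD.
  have h4 : #|avoid O A (S :\ i)| <= #|avoid O A S| + #|A i :&: avoid O A (S :\ i)|.
    apply: leq_trans (_ : #|avoid O A S :|: (A i :&: avoid O A (S :\ i))| <= _).
      apply/subset_leq_card/subsetP => o oS; rewrite !inE.
      move: (oS); rewrite inE => /andP[oO /forall_inP h]; rewrite oO /=.
      case oAi: (o \in A i) => /=; first by apply/orP; right; apply/forall_inP.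
      rewrite orbF; apply/forall_inP => j jS.
      by have [->|ji] := eqVneq j i; rewrite ?oAi // h // !inE ji.
    by rewrite cardsU leq_subr.
  case: (posnP #|avoid O A S|) => // z; move: h2 h3 h4; rewrite z add0n.
  move: h1; set x := #|avoid O A _|; set y := #|A i :&: _| => h1 h2 h3 h4.
  have : 2 * w i * x < Q * x by rewrite ltn_pmul2r.
  have : Q * x <= Q * y by rewrite leq_mul2l h4 orbT.
  by lia.
exact: sub #|D| D (leqnn _) (subxx _).
Qed.

(** * Extending partial embeddings *)

Definition deg (T : finType) (M : {set {set T}}) (Y : {set T}) : nat :=
  #|[set m in M | Y \subset m]|.

Definition extensions (P T : finType) (X : {set P}) (f : {ffun P -> T}) :
    {set {ffun P -> T}} :=
  [set s : {ffun P -> T} | injectiveb s && [forall p in X, s p == f p]].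

Definition graph (P T : finType) (s : {ffun P -> T}) (D : {set P}) :
    {set P * T} :=
  [set (p, s p) | p in D].

Definition hit (P T : finType) (E : {set P * T}) : {set {ffun P -> T}} :=
  [set s : {ffun P -> T} | [forall x in E, s x.1 == x.2]].

(** Sharing a position or a value counts as a clash even when the two prescriptions are
    consistent. *)
Definition clash (P T : finType) (E F : {set P * T}) : bool :=
  [exists x in E, [exists y in F, (x.1 == y.1) || (x.2 == y.2)]].

Lemma card_graph (P T : finType) (s : {ffun P -> T}) (D : {set P}) :
  #|graph s D| = #|D|.
Proof. by rewrite card_imset // => p q []. Qed.

(* The value [x.2] is swapped with any [u] outside the range of [E]; the
   swapped embedding still avoids the events of [S]. *)
Lemma swap_bound (P T : finType) (X : {set P}) (f : {ffun P -> T})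
    (S : {set {set P * T}}) (E : {set P * T}) (x : P * T) (N : nat) :
  x \in E -> (forall y, y \in E -> y.2 \notin f @: X) ->
  (forall F, F \in S -> ~~ clash E F) ->
  N + #|X| + #|E| <= #|T| ->
  N * #|hit E :&: avoid (extensions X f) (@hit P T) S|
    <= #|hit (E :\ x) :&: avoid (extensions X f) (@hit P T) S|.
Proof.
case: x => p v pvE EX ES leN.
pose U := ~: (f @: X :|: [set y.2 | y in E]).
have leNU : N <= #|U|.
  rewrite cardsCs setCK; apply: leq_trans (_ : #|T| - (#|X| + #|E|) <= _).
    by lia.
  apply: leq_sub2l; rewrite cardsU; apply: leq_trans (leq_subr _ _) _.
  by rewrite leq_add // leq_imset_card.
apply: leq_trans (leq_mul leNU (leqnn _)) _; rewrite -cardsX.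
pose g (z : T * {ffun P -> T}) := [ffun q => tperm v z.1 (z.2 q)].
have sv (s : {ffun P -> T}) : s \in hit E -> s p = v.
  by rewrite inE => /forall_inP/(_ _ pvE)/eqP.
(* The pair can be recovered from the swapped embedding, whose value at [p] is [u]. *)
rewrite -(card_in_imset (f := g)); last first.
  case=> [u s] [u' s'] /setXP[/= _ /setIP[/sv su _]].
  move=> /setXP[/= _ /setIP[/sv su' _]] /ffunP eg.
  have eu : u = u' by move: (eg p); rewrite !ffunE /= su su' !tpermL.
  congr (_, _) => //; apply/ffunP => q; move: (eg q); rewrite !ffunE /= eu.
  exact: perm_inj.
apply/subset_leq_card/subsetP => s' /imsetP[[u s]] /setXP[/= uU].
case/setIP => sE sav ->; have sp := sv s sE.
move: sE sav; rewrite inE => /forall_inP sE; rewrite inE => /andP[].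
rewrite inE => /andP[/injectiveP sinj /forall_inP sX] /forall_inP sS.
move: uU; rewrite !inE negb_or => /andP[uX uE].
rewrite /g; apply/andP; split; last (apply/andP; split).
- apply/forall_inP => -[q w]; rewrite !inE ffunE /= => /andP[neq qwE].
  have /eqP sq := sE _ qwE; rewrite /= in sq.
  rewrite sq tpermD //.
    apply: contra neq => /eqP vw.
    by rewrite -vw xpair_eqE eqxx andbT; apply/eqP/sinj; rewrite sq sp.
  apply: contra uE => /eqP uw; apply/imsetP; exists (q, w) => //=.
- apply/andP; split.
    by apply/injectiveP => a b; rewrite !ffunE /= => /perm_inj/sinj.
  apply/forall_inP => q qX; rewrite ffunE /= (eqP (sX q qX)) tpermD //.
    by apply: contra (EX _ pvE) => /eqP /= ->; apply: imset_f.
  by apply: contra uX => /eqP ->; apply: imset_f.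
(* If the swapped embedding hits [F], so does [s]: no value prescribed by [F] is [v], and the value
   [u] would have to be taken at [p], a position that [F] does not use. *)
- apply/forall_inP => F FS; apply: contra (sS F FS).
  rewrite !inE => /forall_inP h; apply/forall_inP => -[q w] qwF /=.
  have := h _ qwF; rewrite ffunE /= => /eqP hw.
  have := ES F FS; rewrite negb_exists_in => /forall_inP/(_ _ pvE).
  rewrite negb_exists_in => /forall_inP/(_ _ qwF) /=.
  rewrite negb_or => /andP[pq vw]; apply/eqP/(@perm_inj _ (tperm v u)).
  rewrite hw tpermD //; apply: contraNneq pq => uw.
  apply/eqP/sinj; rewrite sp; apply/(@perm_inj _ (tperm v u)).
  by rewrite hw tpermL uw.
Qed.

(** The prescribed values are released one at a time, each release gaining a factor [N] by
    [swap_bound]. Thus [hit E] has conditional probability at most 1 over [N ^ #|E|]. *)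
Lemma hit_bound (P T : finType) (X : {set P}) (f : {ffun P -> T})
    (S : {set {set P * T}}) (E : {set P * T}) (N k : nat) :
  #|E| <= k -> (forall y, y \in E -> y.2 \notin f @: X) ->
  (forall F, F \in S -> ~~ clash E F) ->
  N + #|X| + k <= #|T| ->
  N ^ #|E| * #|hit E :&: avoid (extensions X f) (@hit P T) S|
    <= #|avoid (extensions X f) (@hit P T) S|.
Proof.
move=> leEk EX ES leN; move cE : #|E| => m.
elim: m E cE leEk EX ES => [|m IHm] E cE leEk EX ES.
  by rewrite mul1n subset_leq_card ?subsetIr.
have [x xE] : exists x, x \in E by apply/card_gt0P; rewrite cE.
have cE' : #|E :\ x| = m by move: cE; rewrite (cardsD1 x) xE => -[].
apply: leq_trans (_ : N ^ m * #|hit (E :\ x) :&: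
    avoid (extensions X f) (@hit P T) S| <= _).
  rewrite expnSr -mulnA leq_mul2l swap_bound ?orbT // cE; lia.
apply: IHm => //; first by lia.
  by move=> y /setD1P[_ /EX].
move=> F /ES; apply: contra => /exists_inP[y /setD1P[_ yE] h].
by apply/exists_inP; exists y.
Qed.

(* The events of the local lemma are the graphs of the restrictions to
   [e :\: X] of those extensions [s] of [f] that map [e] to an element of [M].
   An event clashes with few others: those whose edge meets [X] are controlled
   by [K2], those sharing a position by [#|M|], and those sharing a vertex by
   [K1]. *)
Lemma embedding_extension (P T : finType) (k c K1 K2 : nat)
    (C : {set {set P}}) (M : {set {set T}}) (X : {set P}) (f : {ffun P -> T}) :
  0 < k ->
  (forall e, e \in C -> #|e| = k) -> (forall m, m \in M -> #|m| = k) ->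
  (forall p, #|[set e in C | p \in e]| <= k) -> #|C| <= #|T| ->
  #|M| <= #|T| ^ (k - 1) -> injective f ->
  (forall e, e \in C ->
     K2 * deg M (f @: (e :&: X)) <= #|T| ^ #|e :\: X|) ->
  (forall v, v \notin f @: X -> K1 * deg M [set v] <= #|T| ^ (k - 1)) ->
  #|X| <= c ->
  12 * k * 2 ^ (k * k) * 2 ^ k <= K1 ->
  12 * c * k * 2 ^ (k * k) * 2 ^ k + 2 <= K2 ->
  12 * k * k * 2 ^ (k * k) * 2 ^ k + 2 * (c + k) <= #|T| ->
  exists s : {ffun P -> T},
    [/\ injective s, {in X, s =1 f} & forall e, e \in C -> s @: e \notin M].
Proof.
move=> k_gt0 Ck Mk Cdeg Ccard Mcard finj good unpl Xc K1ge K2ge.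
set n := #|T| in Ccard Mcard good unpl *; set Z := 2 ^ (k * k) => nge.
(* At least [N] values are available for each swap. As [n <= 2 * N], replacing [n ^ k] by [N ^ k]
   costs only the factor [2 ^ k]. *)
pose N := n - c - k.
have Z_gt0 : 0 < Z by rewrite expn_gt0.
have k2_gt0 : 0 < 2 ^ k by rewrite expn_gt0.
have n2N : n <= 2 * N by rewrite /N; move: nge; lia.
have Nn : N <= n by rewrite /N; lia.
have n_ge : 12 * k * k * Z * 2 ^ k <= n by lia.
have n12 : 12 <= n.
  by apply: leq_trans n_ge; rewrite -!mulnA leq_pmulr // !muln_gt0 k_gt0 Z_gt0.
have nkN : n ^ k <= 2 ^ k * N ^ k by rewrite -expnMn leq_exp2r.
have nk : n ^ k = n * n ^ (k - 1) by rewrite -expnS subn1 prednK.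
have Nexp : forall i, N ^ i <= n ^ i.
  by case=> // i; rewrite leq_exp2r.
pose O := extensions X f.
pose ofEdge (e : {set P}) (R : pred {set T}) (E : {set P * T}) :=
  [exists s in O, [&& s @: e \in M, R (s @: e) & E == graph s (e :\: X)]].
pose D := [set E : {set P * T} | [exists e in C, ofEdge e predT E]].
(* On the scale [Q = N ^ k] this is the probability 1 over [N ^ #|E|] from [hit_bound]. *)
pose w (E : {set P * T}) := N ^ (k - #|E|).
have sO : forall s, s \in O -> injective s /\ {in X, s =1 f}.
  move=> s; rewrite inE => /andP[/injectiveP si /forall_inP h].
  by split=> // p /h/eqP.
have sImX : forall s e, s \in O -> s @: (e :&: X) = f @: (e :&: X).
  by move=> s e /sO[_ h]; apply: eq_in_imset => p /setIP[_ /h].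
have DP : forall E, E \in D -> exists e s, [/\ e \in C, s \in O, s @: e \in M,
    E = graph s (e :\: X) & 0 < #|E| <= k].
  move=> E; rewrite inE => /exists_inP[e eC /exists_inP[s sinO]].
  case/and3P=> eM _ /eqP Ee; exists e, s; split=> //; rewrite Ee card_graph.
  apply/andP; split; last by rewrite -(Ck e eC) subset_leq_card ?subsetDl.
  (* An edge inside [X] yields no event: there [good] bounds [K2 * deg] by 1, while [K2 >= 2] and
     the image would lie in [M]. *)
  rewrite lt0n; apply/negP => /eqP/cards0_eq eX0.
  have /setIidPl eX : e \subset X by rewrite -setD_eq0 eX0.
  have := good e eC; rewrite eX0 cards0.
  have : 0 < deg M (f @: (e :&: X)).
    apply/card_gt0P; exists (s @: e); rewrite inE eM -(sImX s) //.
    by rewrite eX subxx.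
  by rewrite eX; case: (deg _ _) => // d _; rewrite expn0; lia.
(* For a fixed image [m] every event is a subset of [setX e m], so there are at most [Z] of them. *)
have wE : forall e R, e \in C ->
    \sum_(E | ofEdge e R E) w E <=
    #|[set m in M | (f @: (e :&: X) \subset m) && R m]|
      * (Z * n ^ (k - #|e :\: X|)).
  move=> e R eC.
  apply: leq_trans (leq_sum_cover (A := fun m => [&& m \in M,
    f @: (e :&: X) \subset m & R m])
    (Q := fun m E => (E \in powerset (setX e m)) && (#|E| == #|e :\: X|)) _ _) _.
    move=> E /exists_inP[s sinO /and3P[sM sR /eqP ->]]; exists (s @: e).
      by rewrite sM -(sImX s) // sR imsetS // subsetIl.
    rewrite card_graph eqxx andbT powersetE; apply/subsetP => y /imsetP[p].
    by case/setDP => pe _ ->; rewrite inE /= pe imset_f.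
  rewrite -[#|[set m in M | _]|]sum1_card big_distrl /=.
  rewrite [leqLHS](eq_bigl (mem [set m in M |
    (f @: (e :&: X) \subset m) && R m])); last by move=> m; rewrite !inE.
  apply: leq_sum => m; rewrite [in X in X -> _]/= inE => /andP[mM _].
  rewrite mul1n.
  apply: leq_trans (_ : \sum_(E in powerset (setX e m)) n ^ (k - #|e :\: X|) <= _).
    rewrite [leqRHS]big_mkcond big_mkcondr [leqLHS]big_mkcond /=.
    apply: leq_sum => E _; case: ifP => // _.
    by case: eqP => // cE; rewrite /w cE.
  by rewrite sum_nat_const card_powerset cardsX Ck // Mk.
have [s sav] : exists s, s \in avoid O (@hit P T) D; last first.
  move: sav; rewrite inE => /andP[sinO /forall_inP h].
  have [si sX] := sO _ sinO; exists s; split=> // e eC; apply/negP => sM.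
  have /h : graph s (e :\: X) \in D.
    rewrite inE; apply/exists_inP; exists e => //; apply/exists_inP; exists s => //.
    by rewrite sM /=.
  by case/negP; rewrite inE; apply/forall_inP => x /imsetP[p _ ->] /=.
apply/card_gt0P; apply: (@lopsided_local_lemma _ _ O D _ (@clash P T) w (N ^ k)).
- move=> E S /DP[e [s [eC sinO sM Ee /andP[E0 Ek]]]] SD ES.
  have -> : N ^ k = w E * N ^ #|E| by rewrite /w -expnD subnK.
  rewrite -mulnA leq_mul2l (@hit_bound _ _ _ _ _ _ _ k) ?orbT //.
    move=> y; rewrite Ee => /imsetP[p /setDP[pe pX] ->] /=.
    apply: contra pX => /imsetP[q qX]; have [si sX] := sO _ sinO.
    by rewrite -sX // => /si ->.
  by rewrite /N -/n; lia.
- move=> E /DP[e [s [eC sinO sM Ee /andP[E0 Ek]]]].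
  (* The three summands index the events whose edge meets [X], counted whether they clash or not,
     those sharing a position, and those sharing a vertex. Each class will weigh at most
     [N ^ k / 12], which leaves room for the factor 4. *)
  pose A (j : (P * {set P}) + ((P * {set P}) + (T * {set P}))) :=
    match j with
    | inl a => [&& a.1 \in X, a.2 \in C & a.1 \in a.2]
    | inr (inl a) => [&& a.1 \in [set x.1 | x in E],
        (a.2 \in C) && (a.1 \in a.2) & a.2 :&: X == set0]
    | inr (inr a) => [&& a.1 \in [set x.2 | x in E],
        a.2 \in C & a.2 :&: X == set0]
    end.
  pose Q (j : (P * {set P}) + ((P * {set P}) + (T * {set P}))) :=
    match j with
    | inl a => ofEdge a.2 predT
    | inr (inl a) => ofEdge a.2 predT
    | inr (inr a) => ofEdge a.2 [pred m : {set T} | a.1 \in m]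
    end.
  apply: leq_trans (_ : 4 * (\sum_(j | A j) \sum_(F | Q j F) w F) <= _).
    rewrite leq_mul2l /=; apply: leq_sum_cover => F /andP[].
    rewrite inE => /exists_inP[e' e'C e'F].
    case/exists_inP => x xE /exists_inP[y yF xy].
    have [e'X|] := boolP (e' :&: X == set0); last first.
      case/set0Pn => q /setIP[qe' qX].
      by exists (inl (q, e')) => //; rewrite /A /= qX e'C.
    move: (e'F) => /exists_inP[t tO /and3P[tM _ /eqP Fe]].
    rewrite Fe in yF; move: yF => /imsetP[q /setDP[qe' qX] yq].
    have [xy1|] := boolP (x.1 == y.1).
      exists (inr (inl (q, e'))) => //; apply/and3P; split=> //; last exact/andP.
      by apply/imsetP; exists x; rewrite // (eqP xy1) yq.
    move: xy => /orP[->//|/eqP xy2 _].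
    exists (inr (inr (t q, e'))).
      apply/and3P; split=> //; apply/imsetP; exists x => //.
      by rewrite xy2 yq.
    apply/exists_inP; exists t => //; rewrite tM Fe eqxx andbT /=.
    exact: imset_f.
  rewrite big_sumType big_sumType /= 2!mulnDr.
  set S1 := (X in 4 * X + _); set S2 := (X in _ + (4 * X + _)).
  set S3 := (X in _ + (_ + 4 * X)).
  have S1le : 12 * S1 <= N ^ k.
    have e1 : S1 = \sum_(x in X) \sum_(e' in [set e in C | x \in e])
        \sum_(F | ofEdge e' predT F) w F.
      by rewrite pair_big_dep; apply: eq_bigl => -[x e'] /=; rewrite !inE.
    have : K2 * S1 <= #|X| * (k * (Z * n ^ k)).
      rewrite e1; apply: leq_sum_bound => x xX.
      apply: leq_trans (leq_sum_bound (c := Z * n ^ k) _) _; last first.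
        by rewrite leq_mul2r Cdeg orbT.
      move=> e'; rewrite inE => /andP[e'C xe'].
      apply: leq_trans (leq_mul (leqnn K2) (wE e' predT e'C)) _.
      have ce' : #|e' :\: X| <= k by rewrite -(Ck e' e'C) subset_leq_card ?subsetDl.
      have -> : n ^ k = n ^ #|e' :\: X| * n ^ (k - #|e' :\: X|).
        by rewrite -expnD subnKC.
      rewrite mulnA [leqRHS]mulnCA leq_mul2r.
      apply/orP; right; apply: leq_trans (good e' e'C).
      rewrite leq_mul2l; apply/orP; right; apply/subset_leq_card/subsetP => m.
      by rewrite !inE andbT.
    move=> le1; have K2_gt0 : 0 < K2 by lia.
    rewrite -(leq_pmul2l K2_gt0) mulnCA.
    apply: leq_trans (leq_mul (leqnn 12) le1) _.
    apply: leq_trans (_ : 12 * (c * (k * (Z * (2 ^ k * N ^ k)))) <= _).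
      by rewrite leq_mul // leq_mul // leq_mul // leq_mul.
    rewrite !mulnA leq_mul2r; apply/orP; right; lia.
  have S2le : 12 * S2 <= N ^ k.
    have e2 : S2 <= \sum_(p in [set x.1 | x in E]) \sum_(e' in [set e in C | p \in e])
        (Z * n ^ (k - 1)).
      rewrite pair_big_dep [leqRHS]big_mkcond [leqLHS]big_mkcond /=.
      apply: leq_sum => -[p e'] _ /=; rewrite !inE; case: ifP => //.
      case/and3P => -> /= /[dup] pe' -> /= e'X.
      move: pe' => /andP[e'C pe']; apply: leq_trans (wE e' predT e'C) _.
      have -> : #|e' :\: X| = k.
        rewrite -(Ck e' e'C); congr #|pred_of_set _|.
        by apply/setDidPl; rewrite -setI_eq0.
      rewrite subnn expn0 muln1 mulnC leq_mul2l; apply/orP; right.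
      apply: leq_trans Mcard; apply/subset_leq_card/subsetP => m.
      by rewrite inE => /andP[].
    have : 1 * S2 <= k * (k * (Z * n ^ (k - 1))).
      rewrite mul1n; apply: leq_trans e2 _.
      apply: leq_trans (_ : #|[set x.1 | x in E]| * (k * (Z * n ^ (k - 1))) <= _).
        rewrite -[leqLHS]mul1n; apply: leq_sum_bound => p _; rewrite mul1n.
        by rewrite sum_nat_const leq_mul2r Cdeg orbT.
      rewrite leq_mul2r; apply/orP; right; apply: leq_trans Ek.
      exact: leq_imset_card.
    rewrite mul1n => le2; have n_gt0 : 0 < n by lia.
    rewrite -(leq_pmul2l n_gt0).
    apply: leq_trans (_ : n * (12 * (k * (k * (Z * n ^ (k - 1))))) <= _).
      by rewrite !leq_mul2l le2 !orbT.
    have -> : n * (12 * (k * (k * (Z * n ^ (k - 1))))) =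
        12 * k * k * Z * n ^ k.
      by rewrite nk; lia.
    apply: leq_trans (leq_mul (leqnn _) nkN) _.
    by rewrite mulnA leq_mul2r n_ge orbT.
  have S3le : 12 * S3 <= N ^ k.
    have e3 : K1 * S3 <= k * (n * (Z * n ^ (k - 1))).
      have e4 : S3 <= \sum_(v in [set x.2 | x in E]) \sum_(e' in C)
          (Z * deg M [set v]).
        rewrite pair_big_dep [leqRHS]big_mkcond [leqLHS]big_mkcond /=.
        apply: leq_sum => -[v e'] _ /=; case: ifP => // /and3P[-> e'C e'X].
        rewrite e'C /=; apply: leq_trans (wE e' _ e'C) _.
        have -> : #|e' :\: X| = k.
          rewrite -(Ck e' e'C); congr #|pred_of_set _|.
          by apply/setDidPl; rewrite -setI_eq0.
        rewrite subnn expn0 muln1 mulnC leq_mul2l; apply/orP; right.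
        apply/subset_leq_card/subsetP => m.
        by rewrite !inE sub1set => /and3P[-> _ ->].
      apply: leq_trans (leq_mul (leqnn K1) e4) _.
      apply: leq_trans (_ : #|[set x.2 | x in E]| * (n * (Z * n ^ (k - 1))) <= _).
        apply: leq_sum_bound => v /imsetP[x xE ->].
        apply: leq_trans (leq_sum_bound (c := Z * n ^ (k - 1)) _) _.
          move=> e' _; rewrite mulnCA leq_mul2l unpl ?orbT //.
          move: xE; rewrite Ee => /imsetP[p /setDP[pe pX] ->] /=.
          apply: contra pX => /imsetP[q qX]; have [si sX] := sO _ sinO.
          by rewrite -sX // => /si ->.
        by rewrite leq_mul2r Ccard orbT.
      rewrite leq_mul2r; apply/orP; right; apply: leq_trans Ek.
      exact: leq_imset_card.
    have K1_gt0 : 0 < K1.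
      by apply: leq_trans K1ge; rewrite !muln_gt0 k_gt0 Z_gt0 k2_gt0.
    rewrite -(leq_pmul2l K1_gt0) mulnCA.
    apply: leq_trans (leq_mul (leqnn 12) e3) _.
    have -> : 12 * (k * (n * (Z * n ^ (k - 1)))) = 12 * k * Z * n ^ k.
      by rewrite nk; lia.
    apply: leq_trans (leq_mul (leqnn _) nkN) _.
    by rewrite mulnA leq_mul2r K1ge orbT.
  by lia.
- move=> E /DP[e [s [_ _ _ _ /andP[E0 Ek]]]].
  have N3 : 2 < N by lia.
  have -> : N ^ k = N ^ #|E| * w E by rewrite /w -expnD subnKC.
  rewrite ltn_mul2r expn_gt0 (ltn_trans _ N3) //=.
  apply: (leq_trans N3); rewrite -{1}[N]expn1 leq_exp2l //.
  exact: ltn_trans N3.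
- apply/card_gt0P; exists f; rewrite inE; apply/andP; split.
    exact/injectiveP.
  by apply/forall_inP.
Qed.

(** * Cycle edges and planted segments *)

Definition cycle_edge (k d n i : nat) : {set 'I_n} :=
  [set x : 'I_n | [exists j : 'I_k, x == (i * d + j) %% n :> nat]].

Lemma cycle_edgeP (k d n i : nat) (x : 'I_n) :
  reflect (exists2 j, j < k & x = (i * d + j) %% n :> nat)
    (x \in cycle_edge k d n i).
Proof.
rewrite inE; apply: (iffP existsP) => [[j /eqP xj]|[j jk xj]].
  by exists (nat_of_ord j).
by exists (Ordinal jk); apply/eqP.
Qed.

Lemma tight_cycleP (k l n : nat) (e : {set 'I_n}) :
  reflect (exists2 i, i < n %/ (k - l) & e = cycle_edge k (k - l) n i)
    (e \in tight_cycle k l n).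
Proof.
apply: (iffP imsetP) => [[i _ ->]|[i ik ->]]; first by exists (nat_of_ord i).
by exists (Ordinal ik).
Qed.

Lemma card_cycle_edge (k d n i : nat) : k <= n -> #|cycle_edge k d n i| = k.
Proof.
move=> kn; case: (posnP n) => [n0|n_gt0].
  by apply/eqP; rewrite eqn_leq; apply/andP; split;
    [apply: leq_trans (max_card _) _; rewrite card_ord n0 | lia].
rewrite -[RHS]card_ord -cardsT.
pose g (j : 'I_k) : 'I_n := Ordinal (ltn_pmod (i * d + j) n_gt0).
have ginj : injective g.
  move=> j j' /(congr1 val)/= /eqP; rewrite eqn_modDl.
  have jn (q : 'I_k) : q < n by apply: leq_trans kn.
  by rewrite !modn_small // => /eqP/val_inj.
rewrite -(card_imset _ ginj); apply: eq_card => x; apply/cycle_edgeP/imsetP.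
  by case=> j jk xj; exists (Ordinal jk) => //; apply: val_inj.
by case=> j _ ->; exists (nat_of_ord j).
Qed.

Lemma divn_mulm_lt (n d i : nat) : i < n %/ d -> i * d < n.
Proof.
move=> i_lt; have d_gt0 : 0 < d by case: d i_lt => //; rewrite divn0.
apply: leq_trans (leq_divM n d); by rewrite ltn_pmul2r.
Qed.

(** The offset of [p] in an edge determines the edge, because the starting points [i * d] are
    distinct numbers below [n]. *)
Lemma tight_cycle_deg (k l n : nat) (p : 'I_n) :
  l < k -> #|[set e in tight_cycle k l n | p \in e]| <= k.
Proof.
move=> lk; set d := k - l; have d_gt0 : 0 < d by rewrite subn_gt0.
pose J := [set ij : 'I_(n %/ d) * 'I_k | p == (ij.1 * d + ij.2) %% n :> nat].
have -> : [set e in tight_cycle k l n | p \in e] =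
    [set cycle_edge k d n (nat_of_ord ij.1) | ij in J].
  apply/setP => e; rewrite inE; apply/andP/imsetP.
    case=> /tight_cycleP[i ik ->] /cycle_edgeP[j jk pj].
    by exists (Ordinal ik, Ordinal jk); rewrite // inE /= pj.
  case=> -[i j]; rewrite inE /= => /eqP pj ->; split.
    by apply/tight_cycleP; exists (nat_of_ord i).
  by apply/cycle_edgeP; exists (nat_of_ord j).
apply: leq_trans (leq_imset_card _ _) _.
rewrite -[k in leqRHS]card_ord -(@card_in_imset _ _ snd) ?max_card //.
case=> i j [i' j']; rewrite !inE /= => /eqP pj /eqP pj' jj'.
congr (_, _) => //; apply: val_inj; apply/eqP.
have /eqP := etrans (esym pj) pj'; rewrite jj' eqn_modDr !modn_small ?divn_mulm_lt //.
by rewrite eqn_pmul2r.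
Qed.

Lemma card_tight_cycle (k l n : nat) : l < k -> #|tight_cycle k l n| <= n.
Proof.
move=> lk; apply: leq_trans (leq_imset_card _ _) _.
by rewrite card_ord leq_div.
Qed.

(** The values are prescribed one by one, each by composing with a transposition that moves neither
    the image of [X] nor the values prescribed before. *)
Lemma injection_extension (P T : finType) (f : {ffun P -> T}) (X : {set P})
    (pos : nat -> P) (y : nat -> T) (t : nat) :
  injective f ->
  (forall i j, i < t -> j < t -> pos i = pos j -> i = j) ->
  (forall i j, i < t -> j < t -> y i = y j -> i = j) ->
  (forall j, j < t -> pos j \notin X) ->
  (forall j, j < t -> y j \notin f @: X) ->
  exists g : {ffun P -> T}, [/\ injective g, {in X, g =1 f} &
    forall j, j < t -> g (pos j) = y j].
Proof.
move=> finj; elim: t => [|t IHt] posI yI posX yX; first by exists f.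
have [| | | |g [ginj gX gy]] := IHt.
- by move=> i j it jt; apply: posI; apply: ltnW.
- by move=> i j it jt; apply: yI; apply: ltnW.
- by move=> j jt; apply/posX/ltnW.
- by move=> j jt; apply/yX/ltnW.
exists [ffun q => tperm (g (pos t)) (y t) (g q)]; split.
- by move=> a b; rewrite !ffunE => /perm_inj/ginj.
- move=> q qX; rewrite ffunE (gX q qX) tpermD //.
    apply/eqP; rewrite -(gX q qX) => /ginj e.
    by have := posX t (ltnSn t); rewrite e qX.
  by apply: contra (yX t (ltnSn t)) => /eqP ->; apply: imset_f.
- move=> j; rewrite ltnS leq_eqVlt ffunE => /orP[/eqP->|jt].
    by rewrite tpermL.
  rewrite (gy j jt) tpermD //.
    rewrite -(gy j jt); apply/eqP => /ginj/posI e.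
    by have := e (ltnSn t) (ltnW jt); lia.
  by apply/eqP => /yI e; have := e (ltnSn t) (ltnW jt); lia.
Qed.

(** Only the first [N] terms of [z] count; the cut at [N] serves cycle edges that stick out of a
    planted segment. *)
Definition window (T : finType) (z : nat -> T) (N a b : nat) : {set T} :=
  [set z j | j : 'I_N & a <= j < b].

Lemma windowP (T : finType) (z : nat -> T) (N a b : nat) (x : T) :
  reflect (exists2 j, [&& j < N, a <= j & j < b] & x = z j)
    (x \in window z N a b).
Proof.
apply: (iffP imsetP) => [[j]|[j /andP[jN jab] ->]].
  by rewrite inE => jab ->; exists (nat_of_ord j); rewrite ?ltn_ord.
by exists (Ordinal jN); rewrite ?inE.
Qed.

(** The boundary condition of [embedding_extension]. For [K >= 2] it also forces every edge inside
    [X] to avoid [M]. *)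
Definition good (P T : finType) (K : nat) (C : {set {set P}})
    (M : {set {set T}}) (X : {set P}) (f : {ffun P -> T}) : Prop :=
  forall e, e \in C -> K * deg M (f @: (e :&: X)) <= #|T| ^ #|e :\: X|.

(** The gap of [k] positions before [a] keeps every cycle edge from meeting both [X] and the new
    segment, so the condition on edges meeting the segment concerns [y] alone. Truncated subtraction
    handles the edges that start before [a]. *)
Lemma plant_segment (T : finType) (k l n K a t : nat) (M : {set {set T}})
    (X : {set 'I_n}) (f : {ffun 'I_n -> T}) (y : nat -> T) :
  l < k -> k <= a -> a + t + k <= n -> injective f ->
  (forall p, p \in X -> p + k <= a) ->
  good K (tight_cycle k l n) M X f ->
  (forall i j, i < t -> j < t -> y i = y j -> i = j) ->
  (forall j, j < t -> y j \notin f @: X) ->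
  (forall i, let Y := window y t (i * (k - l) - a) (i * (k - l) + k - a) in
     Y != set0 -> K * deg M Y <= #|T| ^ (k - #|Y|)) ->
  exists (X' : {set 'I_n}) (g : {ffun 'I_n -> T}),
    [/\ injective g, #|X'| <= #|X| + t, forall p, p \in X' -> p < a + t,
        good K (tight_cycle k l n) M X' g &
        g @: X' = f @: X :|: window y t 0 t].
Proof.
move=> lk ka atn finj Xa gX yI yX yOK.
have n_gt0 : 0 < n by lia.
pose pos j : 'I_n := Ordinal (ltn_pmod (a + j) n_gt0).
have posE j : j < t -> pos j = a + j :> nat.
  by move=> jt; rewrite /= modn_small //; lia.
have posX j : j < t -> pos j \notin X.
  by move=> jt; apply/negP => /Xa; rewrite posE //; lia.
have [|g [ginj gf gy]] := injection_extension (pos := pos) finj _ yI posX yX.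
  by move=> i j it jt /(congr1 val); rewrite [LHS]posE // [RHS]posE //; lia.
pose A := [set p : 'I_n | a <= p < a + t].
have AP p : reflect (exists2 j, j < t & p = pos j) (p \in A).
  rewrite inE; apply: (iffP andP) => [[ap pat]|[j jt ->]]; last first.
    by rewrite posE //; lia.
  have jt : p - a < t by lia.
  by exists (p - a) => //; apply: val_inj; rewrite [RHS]posE //=; lia.
have gA : g @: A = window y t 0 t.
  apply/setP => x; apply/imsetP/windowP.
    by case=> p /AP[j jt ->] ->; exists j; rewrite ?gy ?jt.
  case=> j /and3P[jt _ _] ->; exists (pos j); last by rewrite gy.
  by apply/AP; exists j.
exists (X :|: A), g; split=> //.
- rewrite cardsU; apply: leq_trans (leq_subr _ _) _; rewrite leq_add2l.
  have -> : A = [set pos j | j : 'I_t].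
    apply/setP => p; apply/AP/imsetP => [[j jt ->]|[j _ ->]].
      by exists (Ordinal jt).
    by exists (nat_of_ord j).
  by rewrite (leq_trans (leq_imset_card _ _)) // card_ord.
- move=> p /setUP[/Xa|]; first by lia.
  by rewrite inE => /andP[].
- move=> e eC; have := eC => /tight_cycleP[i ik ee].
  have [eA0|] := eqVneq (e :&: A) set0.
    have -> : e :\: (X :|: A) = e :\: X.
      apply/setP => p; move/setP/(_ p): eA0.
      rewrite !in_setD !in_setI in_setU in_set0.
      by case: (p \in e); case: (p \in X); case: (p \in A).
    rewrite setIUr eA0 setU0.
    have -> : g @: (e :&: X) = f @: (e :&: X).
      by apply: eq_in_imset => p /setIP[_ /gf].
    exact: gX.
  case/set0Pn => x /setIP[xe xA].
  have id_lt := divn_mulm_lt ik.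
  have [j jk xj] : exists2 j, j < k & x = (i * (k - l) + j) %% n :> nat.
    by apply/cycle_edgeP; rewrite -ee.
  have /andP[ax xat] : a <= x < a + t by move: xA; rewrite inE.
  (* As [k <= a], the position [x] is not reached by wrapping around; then [a + t + k <= n] shows
     that the whole edge does not wrap. *)
  have xE : x = i * (k - l) + j :> nat.
    case: (ltnP (i * (k - l) + j) n) => h; first by rewrite xj modn_small.
    move: xj; rewrite -(subnK h) modnDr modn_small; lia.
  have eP p : p \in e = (i * (k - l) <= p < i * (k - l) + k).
    rewrite ee; apply/cycle_edgeP/idP.
      case=> q qk ->; rewrite modn_small; lia.
    move=> /andP[h1 h2]; exists (p - i * (k - l)); first by lia.
    by rewrite subnKC // modn_small.
  have eX0 : e :&: X = set0.
    apply/setP => p; rewrite !inE eP; apply/negP => /andP[h /Xa]; lia.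
  have -> : e :\: (X :|: A) = e :\: (e :&: A).
    apply/setP => p; move/setP/(_ p): eX0.
    rewrite !in_setD !in_setI in_setU in_set0.
    by case: (p \in e); case: (p \in X); case: (p \in A).
  have -> : e :&: (X :|: A) = e :&: A by rewrite setIUr eX0 set0U.
  have gY : g @: (e :&: A) = window y t (i * (k - l) - a) (i * (k - l) + k - a).
    apply/setP => v; apply/imsetP/windowP.
      case=> p /setIP[pe /AP[q qt pq]] ->; exists q; last by rewrite pq gy.
      move: pe; rewrite pq eP posE //; lia.
    case=> q /and3P[qt h1 h2] ->; exists (pos q); last by rewrite gy.
    rewrite inE eP posE //; apply/andP; split; last by apply/AP; exists q.
    by lia.
  rewrite cardsDS ?subsetIl // -(card_imset (e :&: A) ginj) gY.
  have -> : #|e| = k by rewrite ee card_cycle_edge //; lia.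
  apply: yOK; rewrite -gY; apply/set0Pn; exists (g x).
  by apply: imset_f; rewrite inE xe.
- by rewrite imsetU gA; congr (_ :|: _); apply: eq_in_imset.
Qed.

(** * Copies of [P k l] as sequences and their insertion into the cycle *)

Lemma P_edgeP (k l : nat) (e : {set 'I_(P_order k l)}) : 1 < k -> l < k ->
  reflect (exists2 i, i < k %/ (k - l) &
      e = [set x : 'I_(P_order k l) |
             i * (k - l) <= x < i * (k - l) + (k - 1)])
    (e \in P k l).
Proof.
move=> k_gt1 lk; rewrite /P /tight_path.
have [l0|l_gt0] := posnP l.
  (* For [l = 0] the truncation makes the step of the path [k - 1] instead of [k], but the only edge
     has index 0. *)
  subst l; have -> : (P_order k 0 - (0 - 1)) %/ (k - 1 - (0 - 1)) = 1.
    rewrite /P_order subn0 divnn (ltnW k_gt1) mul1n addn0 !sub0n !subn0 divnn.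
    by rewrite subn_gt0 k_gt1.
  rewrite subn0 divnn (ltnW k_gt1).
  apply: (iffP imsetP) => [[i _ ->]|[i i1 ->]]; first by exists 0; rewrite ?ord1.
  by exists ord0 => //; move: i1; rewrite ltnS leqn0 => /eqP ->.
have -> : k - 1 - (l - 1) = k - l by lia.
have -> : (P_order k l - (l - 1)) %/ (k - l) = k %/ (k - l).
  rewrite /P_order; have -> : k %/ (k - l) * (k - l) + l - 1 - (l - 1) =
    k %/ (k - l) * (k - l) by lia.
  by rewrite mulnK // subn_gt0.
apply: (iffP imsetP) => [[i _ ->]|[i ik ->]]; first by exists (nat_of_ord i).
by exists (Ordinal ik).
Qed.

(** A total sequence makes index shifts easy; its terms from [P_order k l] on are irrelevant. *)
Definition P_copy (T : finType) (k l : nat) (G : {set {set T}})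
    (z : nat -> T) : Prop :=
  (forall i j, i < P_order k l -> j < P_order k l -> z i = z j -> i = j) /\
  forall i, i < k %/ (k - l) ->
    window z (P_order k l) (i * (k - l)) (i * (k - l) + (k - 1)) \in G.

Lemma P_copy_has_copy (T : finType) (k l : nat) (G : {set {set T}})
    (z : nat -> T) :
  1 < k -> l < k -> P_copy k l G z -> has_copy (P k l) G.
Proof.
move=> k_gt1 lk [zI zG]; apply/existsP; exists [ffun j => z (val j)].
apply/andP; split.
  by apply/injectiveP => i j; rewrite !ffunE => zij; apply: val_inj;
    apply: zI zij; apply: ltn_ord.
apply/forall_inP => e /P_edgeP[] // i ik ->.
rewrite (eq_imset _ (g := fun j : 'I_(P_order k l) => z j)); first exact: zG.
by move=> j; rewrite ffunE.
Qed.

Lemma has_copy_P_copy (T : finType) (k l : nat) (G : {set {set T}}) (v : T) :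
  1 < k -> l < k -> has_copy (P k l) G -> exists z, P_copy k l G z.
Proof.
move=> k_gt1 lk /existsP[f /andP[/injectiveP finj /forall_inP fG]].
pose z j := if insub j is Some i then f i else v.
have zE (i : 'I_(P_order k l)) : z i = f i by rewrite /z valK.
exists z; split=> [i j iN jN|i ik].
  have -> : z i = f (Ordinal iN) := zE (Ordinal iN).
  by have -> : z j = f (Ordinal jN) := zE (Ordinal jN); move=> /finj[].
rewrite /window (eq_imset _ zE).
by apply: fG; apply/P_edgeP => //; exists i.
Qed.

(* With [R] as its planted part, an edge with at least one free position has
   few completions in [M]. *)
Definition fine (T : finType) (K k : nat) (M : {set {set T}}) (R : {set T}) :
    bool :=
  K * deg M R <= #|T| ^ (k - #|R|).

(** Subsets are included because a cycle edge leaving the segment meets it in only a part of an edge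
    of the copy. *)
Definition clean (T : finType) (K k : nat) (M G : {set {set T}}) :
    {set {set T}} :=
  [set S in G | [forall R : {set T},
     (R \subset S) && (R != set0) ==> fine K k M R]].

(* [link] as a family of sets over [T] instead of over a subtype. *)
Definition lnk (T : finType) (H : {set {set T}}) (v : T) : {set {set T}} :=
  [set S : {set T} | (v \notin S) && (v |: S \in H)].

(* The vertex at index [l] of a segment of the cycle lies in every full edge of
   the segment [insert_at l v z], [z] being a copy of [P k l], and in no edge
   that leaves it. *)
Definition insert_at (T : finType) (l : nat) (v : T) (z : nat -> T) (j : nat) :
    T :=
  if j < l then z j else if j == l then v else z j.-1.

Lemma P_copy_cover (T : finType) (k l : nat) (G : {set {set T}})
    (z : nat -> T) :
  1 < k -> l < k -> P_copy k l G z ->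
  forall j, j < P_order k l -> exists2 S, S \in G & z j \in S.
Proof.
move=> k_gt1 lk [zI zG] j jN; set d := k - l in zG *.
have d_gt0 : 0 < d by rewrite subn_gt0.
have m_gt0 : 0 < k %/ d by rewrite divn_gt0 // leq_subr.
have qk : k %/ d * d <= k by rewrite leq_divM.
suff [i im /andP[h1 h2]] : exists2 i, i < k %/ d & i * d <= j < i * d + (k - 1).
  by exists (window z (P_order k l) (i * d) (i * d + (k - 1)));
    [apply: zG | apply/windowP; exists j; rewrite ?jN ?h1].
have NE : P_order k l = k %/ d * d + l - 1 by [].
have [jd|] := ltnP j ((k %/ d).-1 * d); last first.
  move=> jd; exists (k %/ d).-1; first by lia.
  have : (k %/ d).-1 * d = k %/ d * d - d by rewrite -subn1 mulnBl mul1n.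
  by lia.
exists (j %/ d).
  by rewrite ltn_divLR //; apply: leq_trans jd _; rewrite leq_mul2r leq_pred orbT.
rewrite leq_divM /=; have := ltn_ceil j d_gt0; rewrite mulSn.
(* For [l = 0] there is a single edge and this case is void; [l > 0] gives [d <= k - 1], so the edge
   starting at the multiple of [d] below [j] contains [j]. *)
have l_gt0 : 0 < l.
  rewrite lt0n; apply/eqP => l0; move: jd; rewrite /d l0 subn0 divnn.
  by rewrite (ltnW k_gt1).
by lia.
Qed.

(** A cycle edge starting at [u < a] starts at least [k - l] earlier, hence ends before index [l]
    and lies in the first edge of the copy. One starting too late for a full edge misses [v] and
    lies in the last edge. Both parts are controlled by cleanness. Any other edge is [v] added to an
    edge of the copy, so it is not in [M]. *)
Lemma insert_copy (T : finType) (k l K a : nat) (M G : {set {set T}}) (v : T)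
    (z : nat -> T) :
  1 < k -> l < k -> (forall m, m \in M -> #|m| = k) ->
  (forall S, S \in G -> [/\ #|S| = k - 1, v \notin S & v |: S \notin M]) ->
  G \subset clean K k M G -> P_copy k l G z -> k - l %| a ->
  let y := insert_at l v z in let t := (P_order k l).+1 in
  [/\ forall i j, i < t -> j < t -> y i = y j -> i = j,
      forall j, j < t -> y j = v \/ exists2 S, S \in G & y j \in S,
      l < t /\ y l = v &
      forall u, k - l %| u -> let Y := window y t (u - a) (u + k - a) in
        Y != set0 -> K * deg M Y <= #|T| ^ (k - #|Y|)].
Proof.
move=> k_gt1 lk Mk Gv sG zP da y t; have [zI zG] := zP.
have cov := P_copy_cover k_gt1 lk zP.
set d := k - l in zG da *; have d_gt0 : 0 < d by rewrite subn_gt0.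
have m_gt0 : 0 < k %/ d by rewrite divn_gt0 // leq_subr.
have qk : k %/ d * d <= k by rewrite leq_divM.
have kq : k < k %/ d * d + d by have := ltn_ceil k d_gt0; rewrite mulSn addnC.
have dq : d <= k %/ d * d by rewrite leq_pmull.
have NE : P_order k l = k %/ d * d + l - 1 by [].
have tE : t = k %/ d * d + l by rewrite /t NE; lia.
have dE : k = d + l by rewrite /d subnK // ltnW.
have zv j : j < P_order k l -> z j <> v.
  by move=> /cov[S SG zS] e; have [_] := Gv S SG; rewrite -e zS.
have ylt j : j < l -> y j = z j by rewrite /y /insert_at => ->.
have yl : y l = v by rewrite /y /insert_at ltnn eqxx.
have ygt j : l < j -> y j = z j.-1.
  by move=> lj; rewrite /y /insert_at ltnNge (ltnW lj) /= gtn_eqF.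
have fineG S (R : {set T}) : S \in G -> R \subset S -> R != set0 ->
    K * deg M R <= #|T| ^ (k - #|R|).
  move=> /(subsetP sG); rewrite inE => /andP[_ /forallP/(_ R)/implyP h] RS R0.
  by apply: h; rewrite RS.
split.
- move=> i j it jt.
  have [il|il|->] := ltngtP i l; have [jl|jl|->] := ltngtP j l;
    rewrite ?yl ?(ylt _ il) ?(ylt _ jl) ?(ygt _ il) ?(ygt _ jl) //.
  + by apply: zI; lia.
  + by move=> /zI e; have := e ltac:(lia) ltac:(lia); lia.
  + by move/zv; case; lia.
  + by move=> /zI e; have := e ltac:(lia) ltac:(lia); lia.
  + by move=> /zI e; have := e ltac:(lia) ltac:(lia); lia.
  + by move/zv; case; lia.
  + by move/esym/zv; case; lia.
  + by move/esym/zv; case; lia.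
- move=> j jt; have [jl|jl|->] := ltngtP j l; last by left.
    by right; rewrite ylt //; apply: cov; lia.
  by right; rewrite ygt //; apply: cov; lia.
- by split=> //; rewrite tE; lia.
move=> u du Y Y0.
have [ua|au] := ltnP u a.
  have dau : d <= a - u by apply: dvdn_leq; [rewrite subn_gt0 | apply: dvdn_sub].
  apply: (fineG _ _ (zG 0 m_gt0)) => //.
  apply/subsetP => x /windowP[j /and3P[h1 h2 h3] ->].
  rewrite ylt; last by lia.
  by apply/windowP; exists j => //; lia.
have [h uE] : exists h, u - a = h * d by apply/dvdnP/dvdn_sub.
have [hm|mh] := ltnP h (k %/ d); last first.
  have qh : k %/ d * d <= h * d by rewrite leq_mul2r mh orbT.
  have e1 : (k %/ d).-1 * d = k %/ d * d - d by rewrite -subn1 mulnBl mul1n.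
  have m1 : (k %/ d).-1 < k %/ d by lia.
  apply: (fineG _ _ (zG _ m1)) => //.
  apply/subsetP => x /windowP[j /and3P[h1 h2 h3] ->].
  rewrite ygt; last by lia.
  by apply/windowP; exists j.-1 => //; rewrite e1; lia.
have qh : h * d + d <= k %/ d * d by rewrite addnC -mulSn leq_mul2r hm orbT.
have YE : Y = v |: window z (P_order k l) (h * d) (h * d + (k - 1)).
  apply/setP => x; rewrite in_setU1; apply/windowP/orP.
    case=> j /and3P[h1 h2 h3] ->.
    have [jl|jl|->] := ltngtP j l; last by left; rewrite yl.
      by right; rewrite ylt //; apply/windowP; exists j => //; lia.
    by right; rewrite ygt //; apply/windowP; exists j.-1 => //; lia.
  case=> [/eqP ->|/windowP[j /and3P[h1 h2 h3] ->]].
    by exists l; rewrite ?yl //; lia.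
  have [jl|lj] := ltnP j l; first by exists j; rewrite ?ylt //; lia.
  by exists j.+1; rewrite ?ygt //; lia.
have [cS vS SM] := Gv _ (zG h hm).
have -> : deg M Y = 0; last by rewrite muln0.
apply/eqP; rewrite cards_eq0; apply/set0Pn => -[m].
rewrite inE => /andP[mM Ym].
have e : Y = m.
  apply/eqP; rewrite eqEcard Ym /= (Mk m mM) YE cardsU1 vS cS; lia.
by move: SM; rewrite -YE e mM.
Qed.

Lemma bin_leq_exp (n m : nat) : 'C(n, m) <= n ^ m.
Proof.
apply: leq_trans (_ : n ^_ m <= _).
  by rewrite -bin_ffact leq_pmulr // fact_gt0.
rewrite ffact_prod; apply: leq_trans (_ : \prod_(i < m) n <= _).
  by apply: leq_prod => i _; apply: leq_subr.
by rewrite prod_nat_const card_ord.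
Qed.

Lemma card_supersets (T : finType) (s : nat) (R : {set T}) :
  #|[set S : {set T} | (#|S| == s) && (R \subset S)]| <= #|T| ^ (s - #|R|).
Proof.
apply: leq_trans (bin_leq_exp _ _); rewrite -card_draws.
rewrite -(card_in_imset (f := fun S => S :\: R)).
  apply/subset_leq_card/subsetP => D /imsetP[S]; rewrite !inE.
  by move=> /andP[/eqP <- RS] ->; rewrite cardsDS.
move=> S S'; rewrite !inE => /andP[_ RS] /andP[_ RS'] e.
by rewrite -(setID S R) -(setID S' R) e (setIidPr RS) (setIidPr RS').
Qed.

(* Double counting of the pairs [R \subset m]. The missing edges through [v] do
   not enter the bound, as [v] lies in no [S]: they contribute at most
   [#|T| ^ (k - 1 - #|R|)] to [deg M R]. *)
Lemma unclean_bound (T : finType) (K k : nat) (M G : {set {set T}}) (v : T) :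
  0 < k -> 2 * K <= #|T| -> (forall m, m \in M -> #|m| = k) ->
  (forall S, S \in G -> #|S| = k - 1 /\ v \notin S) ->
  #|T| * #|G :\: clean K k M G|
    <= 2 * K * (2 ^ k * #|[set m in M | v \notin m]|).
Proof.
set n := #|T|; set M0 := [set m in M | v \notin m] => k_gt0 nK Mk Gk.
have n_gt0 : 0 < n by apply/card_gt0P; exists v.
pose bad (R : {set T}) := [&& #|R| < k, v \notin R & ~~ fine K k M R].
have step1 : #|G :\: clean K k M G| <= \sum_(R | bad R) n ^ (k - 1 - #|R|).
  rewrite -sum1_card.
  apply: leq_trans (leq_sum_cover (A := bad)
    (Q := fun R S : {set T} => (#|S| == k - 1) && (R \subset S)) _ _) _.
    move=> S; rewrite !inE negb_and => /andP[/orP[/negP//|nf] SG].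
    move: nf; rewrite negb_forall => /existsP[R].
    rewrite negb_imply => /andP[/andP[RS R0] nf]; have [cS vS] := Gk S SG.
    exists R; last by rewrite cS eqxx.
    rewrite /bad nf andbT; apply/andP; split; last by apply: contra vS => /(subsetP RS).
    by have := subset_leq_card RS; rewrite cS; lia.
  apply: leq_sum => R _; apply: leq_trans (card_supersets _ _).
  by rewrite -sum1_card; apply: leq_sum_subset => S; rewrite inE.
(* Failure of [fine] means [n * p < K * deg M R]. The missing edges through [v] account for at most
   [K * p] on the right, which is at most half of [n * p] by [2 * K <= n]. *)
have step2 R : bad R -> n * n ^ (k - 1 - #|R|) <= 2 * K * deg M0 R.
  case/and3P=> Rk vR; rewrite /fine -/n -ltnNge.
  have kE : k - #|R| = (k - 1 - #|R|).+1 by lia.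
  rewrite kE expnS; set p := n ^ _ => nf.
  have : deg M R <= deg M0 R + p.
    rewrite /deg -(cardsID [set m : {set T} | v \notin m]).
    apply: leq_add; first by apply/subset_leq_card/subsetP => m; rewrite !inE;
      case: (m \in M); case: (v \in m); case: (R \subset m).
    have -> : p = n ^ (k - #|v |: R|).
      by rewrite cardsU1 vR /p; congr (n ^ _); lia.
    apply: leq_trans (card_supersets _ _).
    apply/subset_leq_card/subsetP => m; rewrite !inE negbK.
    by case/and3P=> vm mM Rm; rewrite (Mk m mM) eqxx /= subUset sub1set vm.
  move: nf nK; nia.
apply: leq_trans (leq_mul (leqnn n) step1) _.
apply: leq_trans (_ : \sum_(R | bad R) 2 * K * deg M0 R <= _).
  by rewrite big_distrr /=; apply: leq_sum.
rewrite -big_distrr leq_mul2l /=; apply/orP; right.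
apply: leq_trans (_ : \sum_(R | bad R) \sum_(m in M0 | R \subset m) 1 <= _).
  apply: leq_sum => R _; rewrite /deg -sum1_card.
  by apply: leq_sum_subset => m; rewrite inE.
rewrite (exchange_big_dep (mem M0)) /=; last by move=> R m _ /andP[].
rewrite mulnC -sum_nat_const; apply: leq_sum => m.
rewrite inE => /andP[mM _]; rewrite -(Mk m mM) -card_powerset -sum1_card.
by apply: leq_sum_subset => R; rewrite powersetE => /andP[_ /andP[]].
Qed.

(** * Turán numbers, links and tight paths *)

Lemma leq_card_ex_num (U T : finType) (k : nat) (F : {set {set U}})
    (H : {set {set T}}) :
  uniform k H -> free F H -> #|H| <= ex_num k #|T| F.
Proof.
move=> /forall_inP Hk Hfree; pose H' := [set enum_rank @: e | e : {set T} in H].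
have rI := @enum_rank_inj T.
have -> : #|H| = #|H'| by rewrite card_imset //; apply: imset_inj.
apply: (@leq_bigmax_cond _ _ (fun H : {set {set 'I_#|T|}} => #|H|)).
apply/andP; split.
  by apply/forall_inP => e' /imsetP[e eH ->]; rewrite card_imset // Hk.
apply: contra Hfree => /existsP[f /andP[/injectiveP fI /forall_inP fH]].
apply/existsP; exists [ffun u => enum_val (f u)]; apply/andP; split.
  by apply/injectiveP => u u'; rewrite !ffunE => /enum_val_inj/fI.
apply/forall_inP => e /fH /imsetP[e' e'H fe].
suff -> : [ffun u => enum_val (f u)] @: e = e' by [].
apply/setP => x; apply/imsetP/idP => [[u ue ->]|xe'].
  have : f u \in f @: e by apply: imset_f.
  by rewrite fe ffunE => /imsetP[y ye ->]; rewrite enum_rankK.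
have : enum_rank x \in f @: e by rewrite fe imset_f.
by case/imsetP => u ue ru; exists u; rewrite // ffunE -ru enum_rankK.
Qed.

Definition pullback (T : finType) (p : pred T) (G : {set {set T}}) :
    {set {set {x : T | p x}}} :=
  [set S : {set {x : T | p x}} | val @: S \in G].

Lemma pullback_uniform (T : finType) (p : pred T) (r : nat)
    (G : {set {set T}}) :
  (forall S, S \in G -> #|S| = r) -> uniform r (pullback p G).
Proof.
move=> Gr; apply/forall_inP => S; rewrite inE => /Gr.
by rewrite card_imset; [move=> -> | apply: val_inj].
Qed.

Lemma card_pullback (T : finType) (p : pred T) (G : {set {set T}}) :
  (forall S, S \in G -> {subset S <= p}) -> #|pullback p G| = #|G|.
Proof.
move=> Gp; have vI : injective (fun S : {set {x : T | p x}} => val @: S).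
  exact/imset_inj/val_inj.
rewrite -(card_imset _ vI); apply: eq_card => S; apply/imsetP/idP.
  by case=> S'; rewrite inE => h ->.
move=> SG; have SE : val @: [set x : {x : T | p x} | val x \in S] = S.
  apply/setP => x; apply/imsetP/idP => [[y]|xS]; first by rewrite inE => yS ->.
  by exists (Sub x (Gp S SG x xS)); rewrite ?inE SubK.
by exists [set x : {x : T | p x} | val x \in S]; rewrite ?inE SE.
Qed.

Lemma has_copy_pullback (U T : finType) (p : pred T) (F : {set {set U}})
    (G : {set {set T}}) :
  has_copy F (pullback p G) -> has_copy F G.
Proof.
case/existsP => f /andP[/injectiveP fI /forall_inP fG].
apply/existsP; exists [ffun u => val (f u)]; apply/andP; split.
  by apply/injectiveP => u u'; rewrite !ffunE => /val_inj/fI.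
apply/forall_inP => e /fG; rewrite inE -imset_comp.
by congr (_ \in G); apply: eq_imset => u; rewrite ffunE.
Qed.

(** Since its sets avoid [v], the family lives on one vertex less, where it exceeds the Turán
    number. *)
Lemma has_copy_of_card (U T : finType) (r : nat) (F : {set {set U}})
    (G : {set {set T}}) (v : T) :
  (forall S, S \in G -> #|S| = r /\ v \notin S) ->
  ex_num r #|T|.-1 F < #|G| -> has_copy F G.
Proof.
move=> Gr ltG; pose p := [pred x : T | x != v].
apply: (@has_copy_pullback _ _ p); apply: contraLR ltG => nF.
rewrite -leqNgt -(@card_pullback _ p); last first.
  by move=> S /Gr[_ vS] x xS; suff : x != v by []; apply: contraNneq vS => <-.
have -> : #|T|.-1 = #|{: {x : T | p x}}|.
  by rewrite card_sig -(cardC1 v).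
by apply: leq_card_ex_num => //; apply: pullback_uniform => S /Gr[].
Qed.

Lemma link_pullback (T : finType) (H : {set {set T}}) (v : T) :
  link H v = pullback [pred x : T | x != v] (lnk H v).
Proof.
apply/setP => S; rewrite !inE; case: (_ \in H); rewrite ?andbF ?andbT //.
by apply/esym/imsetP => -[x _ e]; have := valP x; rewrite /= -e eqxx.
Qed.

Lemma card_link (T : finType) (H : {set {set T}}) (v : T) :
  #|link H v| = #|lnk H v|.
Proof.
rewrite link_pullback card_pullback // => S; rewrite inE => /andP[vS _] x xS.
by suff : x != v by []; apply: contraNneq vS => <-.
Qed.

Lemma has_copy_link (U T : finType) (F : {set {set U}}) (H : {set {set T}})
    (v : T) :
  has_copy F (link H v) -> has_copy F (lnk H v).
Proof. by rewrite link_pullback; apply: has_copy_pullback. Qed.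

Definition missing (T : finType) (k : nat) (H : {set {set T}}) :
    {set {set T}} :=
  [set m : {set T} | (#|m| == k) && (m \notin H)].

Lemma card_missing (T : finType) (k : nat) (H : {set {set T}}) :
  uniform k H -> #|missing k H| + #|H| = 'C(#|T|, k).
Proof.
move=> /forall_inP Hk; rewrite -card_draws -[RHS](cardsID H) addnC.
congr (_ + _); apply: eq_card => m; rewrite !inE.
  by case mH: (m \in H); rewrite ?andbF // (Hk m mH).
by rewrite andbC.
Qed.

Lemma uniform_lnk (T : finType) (k : nat) (H : {set {set T}}) (v : T) S :
  uniform k H -> S \in lnk H v -> #|S| = k - 1.
Proof.
move=> /forall_inP Hk; rewrite inE => /andP[vS /Hk/eqP].
by rewrite cardsU1 vS => <-; rewrite addKn.
Qed.

(** A set of size [k - 1] avoiding [v] either lies in the link or becomes a missing edge when [v] is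
    added. *)
Lemma card_lnk_missing (T : finType) (k : nat) (H : {set {set T}}) (v : T) :
  0 < k -> uniform k H ->
  #|lnk H v| + deg (missing k H) [set v] = 'C(#|T|.-1, k - 1).
Proof.
move=> k_gt0 Hk.
have sC (S : {set T}) : (S \subset [set~ v]) = (v \notin S).
  by rewrite subsets_disjoint setCK disjoint_sym disjoints1.
rewrite -(cardsC1 v) -cards_draws -[RHS](cardsID (lnk H v)).
congr (_ + _).
  apply: eq_card => S; rewrite in_setI andb_idl // => Sv.
  rewrite inE (uniform_lnk Hk Sv) eqxx andbT.
  move: Sv; rewrite inE => /andP[vS _]; apply/subsetP => x xS; rewrite !inE.
  by apply: contraNneq vS => <-.
rewrite /deg -[RHS](card_in_imset (f := fun S => v |: S)); last first.
  move=> S S'; rewrite !inE !sC => /and3P[_ vS _] /and3P[_ vS' _] e.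
  by rewrite -(setU1K vS) e setU1K.
apply: eq_card => m; apply/idP/imsetP.
  rewrite !inE sub1set => /andP[/andP[/eqP mk mH] vm].
  exists (m :\ v); last by rewrite setD1K.
  rewrite !inE setD1K // (negbTE mH) andbF /= sC setD11 /=.
  by move: mk; rewrite (cardsD1 v) vm => <-; rewrite addKn.
case=> S; rewrite !inE sC => /andP[h /andP[vS /eqP cS]] ->.
rewrite vS /= in h; rewrite h sub1set setU11 cardsU1 vS cS; lia.
Qed.

Definition shadow (T : finType) (G : {set {set T}}) : {set {set T}} :=
  [set S : {set T} | [exists A in G, [exists x in A, S == A :\ x]]].

(* Repeatedly delete the edges through a shadow set of degree at most [t]. *)
Lemma dense_core (T : finType) (t : nat) (G : {set {set T}}) :
  t * #|shadow G| < #|G| ->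
  exists G' : {set {set T}}, [/\ G' \subset G, G' != set0 &
    forall A x, A \in G' -> x \in A -> t < deg G' (A :\ x)].
Proof.
have [N] := ubnP #|G|; elim: N G => // N IHN G; rewrite ltnS => leGN ltG.
case: (boolP [exists A in G, [exists x in A, deg G (A :\ x) <= t]]); last first.
  rewrite negb_exists_in => /forall_inP h; exists G; split=> //.
    by rewrite -card_gt0; apply: leq_ltn_trans ltG.
  move=> A x /h; rewrite negb_exists_in => /forall_inP h' /h'.
  by rewrite -ltnNge.
case/exists_inP => A AG /exists_inP[x xA low].
pose B := [set S in G | A :\ x \subset S].
have cG : #|G :\: B| = #|G| - #|B|.
  by rewrite cardsDS //; apply/subsetP => S; rewrite inE => /andP[].
have B_gt0 : 0 < #|B| by apply/card_gt0P; exists A; rewrite inE AG subsetDl.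
have leBG : #|B| <= #|G|.
  by apply/subset_leq_card/subsetP => S; rewrite inE => /andP[].
(* The shadow loses [A :\ x] while at most [t] edges are deleted, so the density hypothesis
   persists. *)
have cS : #|shadow (G :\: B)| < #|shadow G|.
  apply/proper_card/properP; split.
    apply/subsetP => S; rewrite !inE => /exists_inP[A' /setDP[A'G _] h].
    by apply/exists_inP; exists A'.
  exists (A :\ x).
    by rewrite inE; apply/exists_inP; exists A => //; apply/exists_inP; exists x.
  rewrite inE; apply/exists_inP => -[A' /setDP[A'G A'B] /exists_inP[y _ /eqP e]].
  by move: A'B; rewrite inE A'G e subsetDl.
have leBt : #|B| <= t by [].
have [||G' [sG' G'0 G'd]] := IHN (G :\: B).
- by rewrite cG; lia.
- rewrite cG; have : t * #|shadow (G :\: B)| + t <= t * #|shadow G|.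
    by rewrite -mulnSr leq_mul2l cS orbT.
  by lia.
by exists G'; split=> //; apply: subset_trans sG' (subsetDl _ _).
Qed.

Lemma card_window (T : finType) (z : nat -> T) (N a b : nat) :
  #|window z N a b| <= N.
Proof.
by apply: leq_trans (leq_imset_card _ _) _; rewrite -[leqRHS]card_ord max_card.
Qed.

(** Greedy extension: the last edge without its first vertex has more than [t] completions, and at
    most [t] vertices are already used. *)
Lemma tight_path_of_core (T : finType) (r t : nat) (G : {set {set T}}) :
  0 < r -> (forall A, A \in G -> #|A| = r) -> G != set0 ->
  (forall A x, A \in G -> x \in A -> t < deg G (A :\ x)) ->
  forall s, r + s <= t.+1 -> exists z : nat -> T,
    (forall i j, i < r + s -> j < r + s -> z i = z j -> i = j) /\
    (forall i, i <= s -> window z (r + s) i (i + r) \in G).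
Proof.
move=> r_gt0 Gr /set0Pn[A AG] Gd; elim=> [|s IHs] rst.
  have [x xA] : exists x, x \in A by apply/card_gt0P; rewrite Gr.
  exists (nth x (enum A)); rewrite addn0.
  have szA : size (enum A) = r by rewrite -cardE Gr.
  split=> [i j ir jr /eqP|i].
    by rewrite nth_uniq ?szA ?enum_uniq // => /eqP.
  rewrite leqn0 => /eqP ->; suff -> : window (nth x (enum A)) r 0 (0 + r) = A by [].
  apply/setP => y; apply/windowP/idP => [[j /and3P[jr _ _] ->]|yA].
    by rewrite -mem_enum mem_nth ?szA.
  exists (index y (enum A)); last by rewrite nth_index ?mem_enum.
  by rewrite -szA index_mem mem_enum yA.
have [|z [zI zG]] := IHs; first by lia.
pose N := r + s; pose W := window z N s (s + r).
have WG : W \in G by apply: zG.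
have zsW : z s \in W by apply/windowP; exists s => //; rewrite /N; lia.
pose Z := window z N 0 N.
have [S] : exists S, S \in [set S in G | W :\ z s \subset S] :\:
    [set x |: (W :\ z s) | x in Z].
  apply/set0Pn; rewrite setD_eq0; apply/negP => /subset_leq_card.
  have := Gd W (z s) WG zsW; rewrite /deg => h1 h2.
  have h3 : t < #|Z| by apply: leq_trans h1 (leq_trans h2 (leq_imset_card _ _)).
  have h4 : #|Z| <= N by apply: card_window.
  by have := leq_trans h3 h4; rewrite /N; lia.
case/setDP; rewrite inE => /andP[SG WS] SZ.
have /cards1P[x Sx] : #|S :\: (W :\ z s)| == 1.
  rewrite cardsDS // (Gr S SG); have := Gr W WG; rewrite (cardsD1 (z s)) zsW.
  lia.
have SE : S = x |: (W :\ z s) by rewrite -Sx setUC -{1}(setID S (W :\ z s)) (setIidPr WS).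
have xZ : x \notin Z by apply: contra SZ => xZ; rewrite SE; apply: imset_f.
have zx j : j < N -> z j <> x.
  by move=> jN e; case/negP: xZ; apply/windowP; exists j; rewrite ?jN // e.
pose z' j := if j == N then x else z j.
have z'N : z' N = x by rewrite /z' eqxx.
have z'E j : j < N -> z' j = z j by rewrite /z' => /ltn_eqF ->.
have NE : r + s.+1 = N.+1 by rewrite /N addnS.
exists z'; rewrite NE; split=> [i j|i].
  rewrite !ltnS (leq_eqVlt i) (leq_eqVlt j) => /orP[/eqP->|iN] /orP[/eqP->|jN] //.
  - by rewrite z'N z'E // => /esym/zx; case.
  - by rewrite z'N z'E // => /zx; case.
  - by rewrite !z'E //; apply: zI.
rewrite leq_eqVlt => /orP[/eqP ->|]; last first.
  rewrite ltnS => si; suff -> : window z' N.+1 i (i + r) = window z N i (i + r).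
    exact: zG.
  apply/setP => y; apply/windowP/windowP => -[j /and3P[jN h1 h2] ->].
    have jN' : j < N by rewrite /N; lia.
    by exists j; rewrite ?jN' ?h1 ?h2 ?z'E.
  by exists j; rewrite ?(ltnW jN) ?h1 ?h2 ?z'E ?ltnS ?(ltnW jN).
suff -> : window z' N.+1 s.+1 (s.+1 + r) = S by [].
rewrite SE; apply/setP => y; rewrite in_setU1 in_setD1.
apply/windowP/orP => [[j /and3P[jN h1 h2] ->]|].
  move: jN; rewrite ltnS leq_eqVlt => /orP[/eqP->|jN].
    by left; rewrite z'N.
  right; rewrite z'E //; apply/andP; split.
    by apply/eqP => /zI e; have := e jN ltac:(rewrite /N; lia); lia.
  by apply/windowP; exists j => //; move: jN; rewrite /N; lia.
case=> [/eqP ->|/andP[yz /windowP[j /and3P[jN h1 h2] ye]]].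
  by exists N; rewrite ?z'N // /N; lia.
exists j; last by rewrite z'E.
have js : j != s by apply: contra yz => /eqP <-; rewrite ye.
by move: jN js; rewrite /N; lia.
Qed.

(** The shadow has at most [#|T| ^ (k - 2)] sets, so there is a core of minimum degree above
    [2 * k], enough for the [2 * (k - 1)] vertices of the path. *)
Lemma dense_tight_path (T : finType) (k : nat) (G : {set {set T}}) :
  1 < k -> (forall S, S \in G -> #|S| = k - 1) ->
  2 * k * #|T| ^ (k - 2) < #|G| ->
  exists z, P_copy k (k - 1) G z.
Proof.
move=> k_gt1 Gk ltG.
have [|G' [/subsetP sG G'0 G'd]] := @dense_core _ (2 * k) G.
  apply: leq_ltn_trans ltG; rewrite leq_mul2l; apply/orP; right.
  apply: leq_trans (bin_leq_exp _ _); rewrite -card_draws.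
  apply/subset_leq_card/subsetP => S; rewrite !inE.
  case/exists_inP => A /Gk cA /exists_inP[x xA /eqP ->].
  by move: cA; rewrite (cardsD1 x) xA; lia.
have [|||z [zI zG]] := tight_path_of_core _ _ G'0 G'd (s := k - 1) (r := k - 1).
- lia.
- by move=> A /sG/Gk.
- lia.
have d1 : k - (k - 1) = 1 by lia.
have NE : P_order k (k - 1) = k - 1 + (k - 1).
  by rewrite /P_order d1 divn1 muln1; lia.
exists z; rewrite /P_copy NE d1 divn1; split=> // i ik.
by rewrite muln1; apply/sG/zG; lia.
Qed.

(** * Hamiltonian cycles *)

(** [F] stands for the vertices used by earlier segments. The inclusion of [G] in its own clean part
    says that all its sets are clean. *)
Definition plantable (T : finType) (K k l : nat) (M : {set {set T}}) (v : T)
    (F : {set T}) : Prop :=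
  exists (G : {set {set T}}) (z : nat -> T),
    [/\ forall S, S \in G -> [/\ #|S| = k - 1, v \notin S & v |: S \notin M],
        forall S, S \in G -> [disjoint S & F],
        G \subset clean K k M G & P_copy k l G z].

(** The copy may have another tightness [l']: cycle edges start at multiples of [k - l], hence of
    [k - l']. Ordinary bad vertices take [l' = k - 1], where density suffices, and [v0] takes
    [l' = l]. The segment fills at most [2 * k] positions and [k] more stay free after it. *)
Lemma plant_vertex (T : finType) (k l l' n K a : nat) (M : {set {set T}})
    (X : {set 'I_n}) (f : {ffun 'I_n -> T}) (v : T) :
  1 < k -> l < k -> l' < k -> k - l' %| k - l -> k - l %| a -> k <= a ->
  a + 3 * k <= n -> (forall m, m \in M -> #|m| = k) ->
  injective f -> (forall p, p \in X -> p + k <= a) ->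
  good K (tight_cycle k l n) M X f ->
  v \notin f @: X -> plantable K k l' M v (f @: X) ->
  exists (X' : {set 'I_n}) (g : {ffun 'I_n -> T}),
    [/\ injective g, #|X'| <= #|X| + 2 * k,
        forall p, p \in X' -> p + k <= a + 3 * k,
        good K (tight_cycle k l n) M X' g &
        f @: X \subset g @: X' /\ v \in g @: X'].
Proof.
move=> k_gt1 lk lk' dd da ka an Mk fI Xa Xgood vX [G [z [Gv GF sG zP]]].
have da' := dvdn_trans dd da.
have [yI yG [lt yl] yfine] := insert_copy k_gt1 lk' Mk Gv sG zP da'.
set y := insert_at l' v z in yI yG yl yfine; set t := (P_order k l').+1 in yI yG lt yfine.
have t2k : t <= 2 * k.
  by rewrite /t /P_order; have := leq_divM k (k - l'); lia.
have yX j : j < t -> y j \notin f @: X.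
  move=> /yG[->//|[S SG yS]]; have := GF S SG.
  by rewrite disjoints_subset => /subsetP/(_ _ yS); rewrite inE.
have [||X' [g [gI cX' X'a X'good gX']]] :=
    @plant_segment T k l n K a t M X f y lk ka _ fI Xa Xgood yI yX.
- lia.
- by move=> i Y Y0; apply: yfine => //; rewrite dvdn_mull.
exists X', g; split=> //.
- by lia.
- by move=> p /X'a; lia.
rewrite gX' subsetUl; split=> //; apply/setUP; right.
by apply/windowP; exists l'; rewrite ?lt ?yl.
Qed.

(** Each vertex gets a slot of [3 * k * (k - l)] positions, so that every segment starts at a
    multiple of [k - l]. A vertex already used in an earlier segment is skipped. *)
Lemma plant_all (T : finType) (k l n K c : nat) (M : {set {set T}})
    (bs : seq T) :
  1 < k -> l < k -> (forall m, m \in M -> #|m| = k) ->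
  (forall v, v \in bs -> forall F : {set T}, #|F| <= c ->
     plantable K k (k - 1) M v F) ->
  forall a (X : {set 'I_n}) (f : {ffun 'I_n -> T}),
  k - l %| a -> k <= a -> a + (size bs) * (3 * k * (k - l)) <= n ->
  #|X| + size bs * (2 * k) <= c ->
  injective f -> (forall p, p \in X -> p + k <= a) ->
  good K (tight_cycle k l n) M X f ->
  exists (X' : {set 'I_n}) (g : {ffun 'I_n -> T}),
    [/\ injective g, #|X'| <= c, good K (tight_cycle k l n) M X' g,
        f @: X \subset g @: X' & {subset bs <= g @: X'}].
Proof.
move=> k_gt1 lk Mk; elim: bs => [|v bs IHbs] bsP a X f da ka an cX fI Xa Xgood.
  by exists X, f; split=> //; move: cX; rewrite mul0n addn0.
have d_gt0 : 0 < k - l by rewrite subn_gt0.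
have bsP' u : u \in bs -> forall F : {set T}, #|F| <= c -> plantable K k (k - 1) M u F.
  by move=> ub; apply: bsP; rewrite inE ub orbT.
have step : 3 * k <= 3 * k * (k - l) by rewrite leq_pmulr.
rewrite /= !(mulSn (size bs)) in an cX.
set w := 3 * k * (k - l) in an step IHbs *.
have [vX|vX] := boolP (v \in f @: X).
  have [||X' [g [gI cX' X'good sX sbs]]] := IHbs bsP' a X f da ka _ _ fI Xa Xgood.
  - by lia.
  - by apply: leq_trans cX; rewrite leq_add2l leq_addl.
  exists X', g; split=> // u; rewrite inE => /orP[/eqP ->|/sbs //].
  exact: (subsetP sX).
have d1 : k - (k - 1) = 1 by lia.
have [||||X1 [f1 [f1I cX1 X1a X1good [sX1 vX1]]]] :=
    @plant_vertex T k l (k - 1) n K a M X f v k_gt1 lk _ _ da ka _ Mk fI Xa Xgood vX.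
- by lia.
- by rewrite d1 dvd1n.
- by lia.
- apply: bsP; rewrite ?inE ?eqxx // card_imset //.
  by apply: leq_trans cX; apply: leq_addr.
have [|||||X' [g [gI cX' X'good sX sbs]]] :=
    IHbs bsP' (a + w) X1 f1 _ _ _ _ f1I _ X1good.
- by rewrite dvdn_add // dvdn_mull.
- by lia.
- by lia.
- by apply: leq_trans cX; rewrite addnA leq_add2r.
- by move=> p /X1a; lia.
exists X', g; split=> //; first exact: subset_trans sX1 sX.
move=> u; rewrite inE => /orP[/eqP ->|/sbs //].
exact: (subsetP sX).
Qed.

Lemma exp_leq_bin (n k : nat) :
  0 < k -> 2 * k <= n -> n ^ (k - 1) <= 2 ^ k * k`! * 'C(n.-1, k - 1).
Proof.
case: k => // k _ kn; rewrite subn1 /=.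
apply: leq_trans (_ : 2 ^ k * (n.-1 ^_ k) <= _).
  rewrite ffact_prod -[k in 2 ^ k]card_ord -prod_nat_const -big_split /=.
  rewrite -{1}[k]card_ord -prod_nat_const.
  by apply: leq_prod => i _; have := ltn_ord i; lia.
rewrite -bin_ffact mulnCA mulnC leq_mul2r expnS factS.
by apply/orP; right; rewrite -mulnA; apply: leq_trans (leq_pmull _ _); lia.
Qed.

(** Few missing edges contain both [v] and [v0], so [v] lies in little more than half of them and
    its link keeps nearly half of all possible sets. Discarding the unclean sets and those meeting
    [F] costs only [O(n ^ (k - 2))]. *)
Lemma plantable_dense (T : finType) (k K c : nat) (H : {set {set T}})
    (v v0 : T) (F : {set T}) :
  1 < k -> uniform k H -> let M := missing k H in
  #|M| <= 'C(#|T|.-1, k - 1) -> v != v0 -> deg M [set v] <= deg M [set v0] ->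
  #|F| <= c -> 2 * k <= #|T| -> 2 * K <= #|T| ->
  2 ^ k * k`! * (1 + 2 * (2 * K * 2 ^ k + c + 2 * k)) < #|T| ->
  plantable K k (k - 1) M v F.
Proof.
move=> k_gt1 Hk M leM vv0 degv Fc nk nK; set n := #|T| in leM nk nK * => nbig.
have Mk m : m \in M -> #|m| = k by rewrite inE => /andP[/eqP].
have n_gt0 : 0 < n by lia.
pose L := lnk H v.
have Lv S : S \in L -> [/\ #|S| = k - 1, v \notin S & v |: S \notin M].
  move=> SL; have := SL; rewrite inE => /andP[vS vH].
  by split; rewrite ?(uniform_lnk Hk SL) // inE vH andbF.
pose G := [set S in clean K k M L | [disjoint S & F]].
have GL S : S \in G -> S \in L by rewrite !inE => /andP[/andP[]].
have sG : G \subset clean K k M G.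
  apply/subsetP => S SG; rewrite inE SG.
  by move: SG; rewrite inE => /andP[]; rewrite inE => /andP[].
have nE : n ^ (k - 1) = n * n ^ (k - 2).
  by rewrite -expnS; congr (n ^ _); lia.
suff ltG : 2 * k * n ^ (k - 2) < #|G|.
  have [z zP] : exists z, P_copy k (k - 1) G z.
    by apply: dense_tight_path => // S /GL/Lv[].
  by exists G, z; split=> // S; [move/GL/Lv | rewrite inE => /andP[]].
have cut : #|L| <= #|L :\: clean K k M L| + #|F| * n ^ (k - 2) + #|G|.
  rewrite -(cardsID (clean K k M L) L) addnC -addnA leq_add2l.
  rewrite -(cardsID [set S : {set T} | [disjoint S & F]]) addnC.
  apply: leq_add; last first.
    apply/subset_leq_card/subsetP => S; rewrite !in_setI => /andP[/andP[_ h] h'].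
    by rewrite inE h; rewrite inE in h'.
  rewrite -sum1_card.
  apply: leq_trans (leq_sum_cover (A := mem F)
    (Q := fun (x : T) (S : {set T}) => (#|S| == k - 1) && ([set x] \subset S)) _ _) _.
    move=> S; rewrite in_setD in_setI => /andP[SF /andP[SL _]].
    move: SF; rewrite inE => /pred0Pn[x /andP[/= xS xF]].
    by exists x => //=; rewrite sub1set xS; have [-> _ _] := Lv S SL; rewrite eqxx.
  rewrite -[leqRHS]sum_nat_const; apply: leq_sum => x _.
  have -> : k - 2 = k - 1 - #|[set x]| by rewrite cards1; lia.
  apply: leq_trans (card_supersets _ _).
  by rewrite -sum1_card; apply: leq_sum_subset => S; rewrite inE.
have dirty : #|L :\: clean K k M L| <= 2 * K * 2 ^ k * n ^ (k - 2).
  rewrite -(leq_pmul2l n_gt0).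
  apply: leq_trans (@unclean_bound T K k M L v _ _ _ _) _ => //; first by lia.
    by move=> S /Lv[].
  rewrite [leqRHS]mulnCA -nE mulnA leq_mul2l; apply/orP; right.
  apply: leq_trans (_ : #|M| <= _).
    by apply/subset_leq_card/subsetP => m; rewrite inE => /andP[].
  apply: leq_trans leM (leq_trans (bin_leq_exp _ _) _).
  by case: (k - 1) => // j; rewrite leq_exp2r // leq_pred.
have degs : deg M [set v] + deg M [set v0] <= #|M| + n ^ (k - 2).
  rewrite /deg -cardsUI; apply: leq_add.
    by apply/subset_leq_card/subsetP => m; rewrite !inE => /orP[] /andP[].
  have -> : k - 2 = k - #|[set v; v0]| by rewrite cards2 vv0.
  apply: leq_trans (card_supersets _ _).
  apply/subset_leq_card/subsetP => m /setIP[].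
  rewrite inE => /andP[mM vm]; rewrite inE => /andP[_ v0m].
  by rewrite inE (Mk m mM) eqxx subUset vm v0m.
have := card_lnk_missing v (ltnW k_gt1) Hk; rewrite -/M -/L -/n => Lsum.
have low := exp_leq_bin (ltnW k_gt1) nk.
rewrite ltnNge; apply/negP => Gle.
move: nbig low; set Q := 2 ^ k * k`!; set p := n ^ (k - 2) => nbig low.
have p_gt0 : 0 < p by rewrite expn_gt0 n_gt0.
rewrite -/p in cut dirty degs Gle.
have Fp : #|F| * p <= c * p by rewrite leq_mul2r Fc orbT.
have Cle : 'C(n.-1, k - 1) <= (1 + 2 * (2 * K * 2 ^ k + c + 2 * k)) * p by lia.
have : Q * 'C(n.-1, k - 1) <= Q * ((1 + 2 * (2 * K * 2 ^ k + c + 2 * k)) * p).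
  by rewrite leq_mul2l Cle orbT.
rewrite nE -/p in low; rewrite mulnA => up.
have := leq_trans low up; rewrite leq_pmul2r // leqNgt; by rewrite nbig.
Qed.

(** With [M0] the missing edges avoiding [v], the link exceeds the Turán number by at least [#|M0|],
    and fewer than [#|M0|] of its sets are unclean unless [M0] is empty. There is no slack for
    avoiding used vertices: [F] is empty and this vertex is planted first. *)
Lemma plantable_extremal (T : finType) (k l K : nat) (H : {set {set T}})
    (v : T) :
  1 < k -> l < k -> uniform k H -> let M := missing k H in
  #|M| + ex_num (k - 1) #|T|.-1 (P k l) <= 'C(#|T|.-1, k - 1) ->
  has_copy (P k l) (lnk H v) -> 2 * K <= #|T| -> 2 * K * 2 ^ k < #|T| ->
  plantable K k l M v set0.
Proof.
move=> k_gt1 lk Hk M; set n := #|T|; set x := ex_num _ _ _ => leM Pv nK nbig.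
have Mk m : m \in M -> #|m| = k by rewrite inE => /andP[/eqP].
pose L := lnk H v.
have Lv S : S \in L -> [/\ #|S| = k - 1, v \notin S & v |: S \notin M].
  move=> SL; have := SL; rewrite inE => /andP[vS vH].
  by split; rewrite ?(uniform_lnk Hk SL) // inE vH andbF.
have sC : clean K k M L \subset clean K k M (clean K k M L).
  apply/subsetP => S SG; rewrite inE SG.
  by move: SG; rewrite inE => /andP[].
have sCL : clean K k M L \subset L by apply/subsetP => S; rewrite inE => /andP[].
suff : has_copy (P k l) (clean K k M L).
  case/(has_copy_P_copy v k_gt1 lk) => z zP; exists (clean K k M L), z.
  split=> // S SG; first by apply/Lv/(subsetP sCL).
  by rewrite disjoints_subset setC0 subsetT.
have := card_lnk_missing v (ltnW k_gt1) Hk; rewrite -/M -/L -/n => Lsum.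
pose M0 := [set m in M | v \notin m].
have M0E : #|M| = deg M [set v] + #|M0|.
  rewrite -(cardsID [set m : {set T} | v \in m] M); congr (_ + _).
    by apply: eq_card => m; rewrite !inE sub1set.
  by apply: eq_card => m; rewrite !inE andbC.
have dirty := @unclean_bound T K k M L v (ltnW k_gt1) nK Mk
  (fun S SL => let: And3 h1 h2 _ := Lv S SL in conj h1 h2).
rewrite -/n -/M0 mulnA in dirty.
(* If [M0] is empty, then no set of the link is unclean and the assumed copy of [P k l] serves. *)
have [M00|M0_gt0] := posnP #|M0|.
  suff -> : clean K k M L = L by [].
  apply/eqP; rewrite eqEsubset sCL -setD_eq0 -cards_eq0 -leqn0.
  by move: dirty; rewrite M00 muln0 leqn0 muln_eq0 => /orP[/eqP|/eqP -> //]; lia.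
apply: (@has_copy_of_card _ _ (k - 1) _ _ v).
  by move=> S /(subsetP sCL)/Lv[].
rewrite -/n -/x.
have cL : #|L :\: clean K k M L| < #|M0|.
  rewrite -(ltn_pmul2l (_ : 0 < n)); last by lia.
  by apply: leq_ltn_trans dirty _; rewrite ltn_pmul2r.
have : #|L| = #|clean K k M L| + #|L :\: clean K k M L|.
  by rewrite -(cardsID (clean K k M L) L) (setIidPr sCL).
by lia.
Qed.

(** Double counting of incidences: the degrees sum to at most [k * #|M|]. *)
Lemma card_bad_vertices (T : finType) (k K : nat) (M : {set {set T}}) :
  0 < #|T| -> (forall m, m \in M -> #|m| = k) -> #|M| <= #|T| ^ (k - 1) ->
  #|[set v | #|T| ^ (k - 1) < K * deg M [set v]]| <= K * k.
Proof.
move=> n_gt0 Mk leM; set B := [set v | _].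
rewrite -(leq_pmul2r (_ : 0 < #|T| ^ (k - 1))) ?expn_gt0 ?n_gt0 //.
apply: leq_trans (_ : K * (k * #|M|) <= _); last first.
  by rewrite -mulnA !leq_mul2l leM !orbT.
apply: leq_trans (_ : \sum_(v in B) K * deg M [set v] <= _).
  by rewrite -sum_nat_const; apply: leq_sum => v; rewrite inE => /ltnW.
rewrite -big_distrr leq_mul2l /=; apply/orP; right.
apply: leq_trans (_ : \sum_(v in B) \sum_(m in M | v \in m) 1 <= _).
  apply: leq_sum => v _; rewrite /deg -sum1_card.
  by apply: leq_sum_subset => m; rewrite inE sub1set.
rewrite (exchange_big_dep (mem M)) /=; last by move=> v m _ /andP[].
rewrite mulnC -sum_nat_const; apply: leq_sum => m mM.
rewrite -(Mk m mM) -sum1_card; apply: leq_sum_subset => v.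
by case/and3P.
Qed.

Lemma tight_cycle_exists (k l : nat) : 1 < k -> l < k ->
  exists n0 : nat, forall (T : finType) (H : {set {set T}}),
    n0 <= #|T| -> uniform k H ->
    #|missing k H| + ex_num (k - 1) #|T|.-1 (P k l) <= 'C(#|T|.-1, k - 1) ->
    (forall v, has_copy (P k l) (lnk H v)) ->
    has_copy (tight_cycle k l #|T|) H.
Proof.
move=> k_gt1 lk; have k_gt0 := ltnW k_gt1.
pose K1 := 12 * k * 2 ^ (k * k) * 2 ^ k.
(* At most [K1 * k] bad vertices and [v0] are planted, each on at most [2 * k] positions. [K1] does
   not depend on [c], so [K2] can be chosen last. *)
pose c := (K1 * k + 1) * (2 * k).
pose K2 := 12 * c * k * 2 ^ (k * k) * 2 ^ k + 2.
pose n0 := 12 * k * k * 2 ^ (k * k) * 2 ^ k + 2 * (c + k) + 2 * K2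
  + 2 * K2 * 2 ^ k + 2 ^ k * k`! * (1 + 2 * (2 * K2 * 2 ^ k + c + 2 * k))
  + (k + (K1 * k + 2) * (3 * k)) * k + 1.
exists n0 => T H; set n := #|T| => nbig Hk leM Pall.
set M := missing k H in leM.
have Mk m : m \in M -> #|m| = k by rewrite inE => /andP[/eqP].
have n_gt0 : 0 < n by apply: leq_trans nbig; rewrite /n0; lia.
have leMC : #|M| <= 'C(n.-1, k - 1) by lia.
have leMn : #|M| <= n ^ (k - 1).
  apply: leq_trans leMC (leq_trans (bin_leq_exp _ _) _).
  by case: (k - 1) => // j; rewrite leq_exp2r // leq_pred.
have /card_gt0P[v1 _] := n_gt0.
pose v0 := [arg max_(v > v1) deg M [set v]].
have v0max v : deg M [set v] <= deg M [set v0].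
  by rewrite /v0; case: arg_maxnP => // i _ h; apply: h.
have d_gt0 : 0 < k - l by rewrite subn_gt0.
have dk : k - l <= k by apply: leq_subr.
pose f0 : {ffun 'I_n -> T} := [ffun i => enum_val i].
have f0I : injective f0 by move=> i j; rewrite !ffunE => /enum_val_inj.
(* With nothing planted, every edge has [#|M| <= n ^ (k - 1)] completions, and [K2 <= n]. *)
have good0 : good K2 (tight_cycle k l n) M set0 f0.
  move=> e /tight_cycleP[i _ ->]; rewrite setI0 imset0 setD0 card_cycle_edge.
    have -> : deg M set0 = #|M|.
      by apply: eq_card => m; rewrite !inE sub0set andbT.
    have -> : #|T| ^ k = n * n ^ (k - 1) by rewrite -expnS subn1 prednK.
    by rewrite leq_mul //; move: nbig; rewrite /n0; lia.
  by move: nbig; rewrite /n0; lia.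
have [||||X0 [g0 [g0I cX0 X0a X0good [_ v0X]]]] :=
    @plant_vertex T k l l n K2 (k * (k - l)) M set0 f0 v0 k_gt1 lk lk (dvdnn _)
      (dvdn_mull _ (dvdnn _)) (leq_pmulr _ d_gt0) _ Mk f0I _ good0.
- have : k * (k - l) <= k * k by rewrite leq_mul2l dk orbT.
  by move: nbig; rewrite /n0; lia.
- by move=> p; rewrite inE.
- by rewrite imset0 inE.
- rewrite imset0; apply: plantable_extremal => //; move: nbig; rewrite /n0 -/n; lia.
pose B := [set v | n ^ (k - 1) < K1 * deg M [set v]].
have cB : #|B| <= K1 * k by apply: card_bad_vertices.
pose bs := enum (B :\ v0).
have szbs : size bs <= K1 * k.
  by rewrite -cardE; apply: leq_trans cB; apply/subset_leq_card/subsetDl.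
have [||||||X [g [gI cX Xgood sX sbs]]] :=
    @plant_all T k l n K2 c M bs k_gt1 lk Mk _ (k * (k - l) + 3 * k * (k - l)) X0 g0
      _ _ _ _ g0I _ X0good.
- move=> v; rewrite mem_enum => /setD1P[vv0 _] F Fc.
  by apply: plantable_dense vv0 (v0max v) Fc _ _ _ => //; move: nbig;
    rewrite /n0 -/n; lia.
- by rewrite -mulnDl dvdn_mull.
- by apply: leq_trans (leq_addr _ _); apply: leq_pmulr.
- have -> : k * (k - l) + 3 * k * (k - l) + size bs * (3 * k * (k - l)) =
    (k + (size bs + 1) * (3 * k)) * (k - l) by lia.
  apply: leq_trans (_ : (k + (K1 * k + 2) * (3 * k)) * k <= _).
    by rewrite leq_mul // leq_add2l leq_mul2r; apply/orP; right; lia.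
  by move: nbig; rewrite /n0; lia.
- apply: leq_trans (leq_add cX0 (leq_mul szbs (leqnn _))) _.
  by rewrite cards0 /c; lia.
- move=> p /X0a; have : 3 * k <= 3 * k * (k - l) by rewrite leq_pmulr.
  by lia.
have [|||s [sI _ sM]] := @embedding_extension _ T k c K1 K2
    (tight_cycle k l n) M X g k_gt0 _ Mk (fun p => tight_cycle_deg p lk)
    (card_tight_cycle n lk) leMn gI Xgood _ cX (leqnn _) (leqnn _).
- move=> e /tight_cycleP[i _ ->]; rewrite card_cycle_edge //.
  by move: nbig; rewrite /n0; lia.
- move=> v vX; rewrite leqNgt; apply: contra vX => vB.
  have [->|vv0] := eqVneq v v0; first exact: (subsetP sX).
  by apply: sbs; rewrite mem_enum in_setD1 vv0 inE.
- by move: nbig; rewrite /n0 -/n; lia.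
apply/existsP; exists s; apply/andP; split; first exact/injectiveP.
apply/forall_inP => e eC; have := sM e eC.
have /tight_cycleP[i _ ee] := eC.
rewrite inE card_imset // ee card_cycle_edge ?eqxx /= ?negbK //.
by move: nbig; rewrite /n0; lia.
Qed.

(** * The extremal construction *)

(** Some [k %/ (k - l)] consecutive edges of the cycle all contain [v]; deleting [v] from them
    leaves a copy of [P k l]. *)
Lemma tight_cycle_link (T : finType) (k l : nat) (H : {set {set T}}) (v : T) :
  1 < k -> l < k -> k - l %| #|T| -> 2 * k <= #|T| ->
  has_copy (tight_cycle k l #|T|) H -> has_copy (P k l) (lnk H v).
Proof.
set n := #|T|; set d := k - l => k_gt1 lk dn kn.
case/existsP => f /andP[/injectiveP fI /forall_inP fH].
have d_gt0 : 0 < d by rewrite subn_gt0.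
have n_gt0 : 0 < n by lia.
have m_gt0 : 0 < k %/ d by rewrite divn_gt0 // leq_subr.
have qk : k %/ d * d <= k by rewrite leq_divM.
have dE : k = d + l by rewrite /d subnK // ltnW.
have /codomP[p vp] : v \in codom f by rewrite inj_card_onto // card_ord.
(* Counted from the start [q0 * d], the vertex [v] has index [l + o] with [o < d], which lies in
   each of these edges. Adding [n] avoids truncation, and [sk] below skips this index. *)
pose q0 := (p + n - l) %/ d; pose o := (p + n - l) %% d.
have od : o < d by rewrite ltn_mod.
have qo : q0 * d + (l + o) = p + n.
  have := divn_eq (p + n - l) d; rewrite -/q0 -/o; lia.
pose pos j : 'I_n := Ordinal (ltn_pmod (q0 * d + j) n_gt0).
have posI i j : i < n -> j < n -> pos i = pos j -> i = j.
  move=> im jm /(congr1 val)/= /eqP.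
  by rewrite eqn_modDl !modn_small // => /eqP.
have pv : f (pos (l + o)) = v.
  rewrite [RHS]vp; congr (f _); apply: val_inj.
  by rewrite /= qo modnDr modn_small.
pose sk j := if j < l + o then j else j.+1.
have skl j : j < l + o -> sk j = j by rewrite /sk => ->.
have skg j : l + o <= j -> sk j = j.+1 by rewrite /sk ltnNge => ->.
have NE : P_order k l = k %/ d * d + l - 1 by [].
have skn j : j < P_order k l -> sk j < n.
  by rewrite NE /sk => ?; case: (ltnP j (l + o)); lia.
apply: (@P_copy_has_copy _ k l _ (fun j => f (pos (sk j)))) => //; split.
  move=> i j iN jN /fI/(posI _ _ (skn _ iN) (skn _ jN)); rewrite /sk.
  by case: ltnP => ?; case: ltnP => ?; lia.
rewrite -/d => i im.
have idm : i * d + d <= k %/ d * d by rewrite addnC -mulSn leq_mul2r im orbT.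
set S := window _ _ _ _.
have vS : v \notin S.
  have lon : l + o < n by lia.
  apply/negP => /windowP[j /and3P[jN _ _]]; rewrite -pv.
  by move=> /fI/(posI _ _ lon (skn _ jN)); rewrite /sk; case: ltnP => ?; lia.
rewrite inE vS /=.
pose i' := (q0 + i) %% (n %/ d).
have nd_gt0 : 0 < n %/ d by rewrite divn_gt0 // dvdn_leq.
have i'E j : (i' * d + j) %% n = pos (i * d + j).
  by rewrite /= muln_modl divnK // modnDml mulnDl addnA.
suff -> : v |: S = f @: cycle_edge k d n i'.
  by apply/fH/tight_cycleP; exists i'; rewrite // ltn_mod.
apply/setP => x; rewrite in_setU1; apply/orP/imsetP.
  have edge j : i * d <= j -> j < i * d + k -> pos j \in cycle_edge k d n i'.
    move=> h1 h2; apply/cycle_edgeP; exists (j - i * d); first by lia.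
    by rewrite i'E subnKC.
  case=> [/eqP ->|/windowP[j /and3P[jN h1 h2] ->]].
    by exists (pos (l + o)) => //; apply: edge; lia.
  exists (pos (sk j)) => //; rewrite /sk.
  by case: ltnP => ?; apply: edge; lia.
case=> y /cycle_edgeP[j jk yj] ->.
have {yj} -> : y = pos (i * d + j) by apply: val_inj; rewrite [LHS]yj i'E.
have [h|h|->] := ltngtP (i * d + j) (l + o); last by left; rewrite pv.
  right; apply/windowP; exists (i * d + j); last by rewrite skl.
  by rewrite NE; lia.
right; apply/windowP; exists (i * d + j).-1; first by rewrite NE; lia.
by rewrite skg; [congr (f (pos _)); lia | lia].
Qed.

(** The vertex [None] with a [P k l]-free link is added to a complete hypergraph on the other
    vertices; by [tight_cycle_link] at [None] there is no Hamiltonian cycle. *)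
Lemma ex_num_tight_cycle_ge (k l n : nat) :
  1 < k -> l < k -> k - l %| n -> 2 * k <= n ->
  'C(n.-1, k) + ex_num (k - 1) n.-1 (P k l) <= ex_num k n (tight_cycle k l n).
Proof.
case: n => [|[|n]] k_gt1 lk dn kn; [by lia | by lia |].
rewrite [n.+2.-1]/=; set E := ex_num k _ _.
have main (G : {set {set 'I_n.+1}}) : uniform (k - 1) G -> free (P k l) G ->
    'C(n.+1, k) + #|G| <= E.
  move=> Gk Gfree; pose T := option 'I_n.+1.
  have cT : #|{: T}| = n.+2 by rewrite card_option card_ord.
  pose G1 := [set [set Some x | x in S] | S : {set 'I_n.+1} in G] : {set {set T}}.
  pose H := [set e : {set T} | (#|e| == k) &&
    ((None \in e) ==> (e :\ None \in G1))].
  have Hk : uniform k H by apply/forall_inP => e; rewrite inE => /andP[].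
  have SomeI : injective (@Some 'I_n.+1) by move=> x y [].
  have NS (S : {set 'I_n.+1}) : None \notin [set Some x | x in S].
    by apply/imsetP => -[].
  have Hfree : free (tight_cycle k l #|{: T}|) H.
    apply: contra Gfree => cyc.
    have := tight_cycle_link (None : T) k_gt1 lk _ _ cyc.
    rewrite cT => /(_ dn kn)/(has_copy_P_copy (None : T) k_gt1 lk)[z zP].
    (* The default [ord0] is never taken: the copy lies in the link of [None] and its edges cover
       it. *)
    have zE j : j < P_order k l -> Some (odflt ord0 (z j)) = z j.
      move=> /(P_copy_cover k_gt1 lk zP)[S SL zS].
      by case: (z j) zS => //= NoneS; move: SL; rewrite inE NoneS.
    case: zP => zI zG.
    apply: (@P_copy_has_copy _ k l _ (fun j => odflt ord0 (z j))) => //.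
    split=> [i j iN jN zij|i im]; first by apply: zI; rewrite // -zE // zij zE.
    have := zG i im; set W := window z _ _ _.
    rewrite inE => /andP[NW]; rewrite inE setU11 setU1K //=.
    case/andP => _ /imsetP[S SG WS].
    suff -> : window (fun j => odflt ord0 (z j)) (P_order k l) (i * (k - l))
      (i * (k - l) + (k - 1)) = S by [].
    apply: (imset_inj SomeI); rewrite -WS; apply/setP => x.
    apply/imsetP/windowP => [[y /windowP[j jN ->] ->]|[j jN ->]].
      by exists j => //; case/andP: jN => jN _; rewrite zE.
    exists (odflt ord0 (z j)); last by rewrite zE //; case/andP: jN.
    by apply/windowP; exists j.
  have := leq_card_ex_num Hk Hfree; rewrite cT; apply: leq_trans.
  rewrite -(cardsID [set e : {set T} | None \in e] H) addnC.
  apply: leq_add.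
    rewrite -(card_imset (f := fun S : {set 'I_n.+1} =>
      None |: [set Some x | x in S])); last first.
      move=> S S' e; apply: (imset_inj SomeI).
      by rewrite -(setU1K (NS S)) -(setU1K (NS S')) e.
    apply/subset_leq_card/subsetP => e /imsetP[S SG ->].
    rewrite !inE eqxx /= setU1K // cardsU1 NS card_imset //.
    rewrite (eqP (forall_inP Gk S SG)) imset_f // !andbT; lia.
  rewrite [leqLHS](_ : _ = 'C(#|[set~ (None : T)]|, k)); last by rewrite cardsC1 cT.
  rewrite -cards_draws; apply/subset_leq_card/subsetP => e.
  rewrite !inE subsets_disjoint setCK disjoint_sym disjoints1.
  by move=> /andP[/negbTE -> ->].
(* The case of empty [G] allows the binomial to be subtracted, so that the maximum over [G] can be
   bounded term by term. *)
have C_le : 'C(n.+1, k) <= E.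
  have := main set0; rewrite cards0 addn0; apply.
    by apply/forall_inP => e; rewrite inE.
  have [e eP] : exists e, e \in P k l.
    eexists; apply/P_edgeP => //; exists 0 => //.
    by rewrite divn_gt0 ?leq_subr // subn_gt0.
  apply/negP => /existsP[f /andP[_ /forall_inP/(_ e eP)]].
  by rewrite inE.
rewrite -leq_subRL //; apply/bigmax_leqP => G /andP[Gk Gfree].
by rewrite leq_subRL // main.
Qed.

(** At a vertex with a [P k l]-free link the link has at most [x] sets, so at least [#|M|] missing
    edges contain that vertex, that is, all of them. *)
Lemma tight_cycle_stability (k l : nat) : 1 < k -> l < k ->
  exists n0 : nat, forall (T : finType) (H : {set {set T}}),
    n0 <= #|T| -> uniform k H -> free (tight_cycle k l #|T|) H ->
    'C(#|T|.-1, k) + ex_num (k - 1) #|T|.-1 (P k l) <= #|H| ->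
    #|H| <= 'C(#|T|.-1, k) + ex_num (k - 1) #|T|.-1 (P k l) /\
    exists v : T, complete_on k H [set~ v] /\ free (P k l) (link H v).
Proof.
move=> k_gt1 lk; have [n0 cyc] := tight_cycle_exists k_gt1 lk.
exists n0.+1 => T H nbig Hk Hfree; set x := ex_num _ _ _ => leH.
have k_gt0 := ltnW k_gt1.
have MH := card_missing Hk; set M := missing k H in MH.
have binE : 'C(#|T|, k) = 'C(#|T|.-1, k) + 'C(#|T|.-1, k - 1).
  by case: #|T| k nbig k_gt0 {cyc Hk Hfree x leH MH M k_gt1 lk} =>
    // n [//|k] _ _; rewrite /= subn1 binS.
have [v vfree] : exists v, free (P k l) (link H v).
  apply/existsP; apply: contraR Hfree; rewrite negb_exists => /forallP Pv.
  apply: cyc => //; first exact: ltnW.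
    by rewrite -/M -/x; lia.
  by move=> v; apply: has_copy_link; have := Pv v; rewrite negbK.
have le_link : #|lnk H v| <= x.
  have -> : x = ex_num (k - 1) #|{: {y : T | y != v}}| (P k l).
    by rewrite /x card_sig -(cardC1 v).
  rewrite -card_link; apply: leq_card_ex_num => //.
  by rewrite link_pullback; apply: pullback_uniform => S /(uniform_lnk Hk).
have := card_lnk_missing v k_gt0 Hk; rewrite -/M => Lsum.
have degM : deg M [set v] <= #|M|.
  by apply/subset_leq_card/subsetP => m; rewrite inE => /andP[].
split; first by lia.
exists v; split=> //.
have ME : [set m in M | [set v] \subset m] = M.
  apply/eqP; rewrite eqEcard; apply/andP; split.
    by apply/subsetP => m; rewrite inE => /andP[].
  by rewrite -/(deg M [set v]); lia.
apply/forallP => e; apply/implyP => /andP[ev ek]; apply/negPn/negP => eH.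
have : e \in M by rewrite inE ek.
rewrite -ME inE sub1set => /andP[_ /(subsetP ev)].
by rewrite !inE eqxx.
Qed.

Theorem theorem1 (k l : nat) (hk : 2 <= k) (hl : l <= k - 1) :
  exists n0 : nat, forall n : nat, n0 <= n -> k - l %| n ->
    ex_num k n (tight_cycle k l n)
      = 'C(n - 1, k) + ex_num (k - 1) (n - 1) (P k l)
    /\ forall (T : finType) (H : {set {set T}}),
         #|T| = n -> extremal k (tight_cycle k l n) H ->
         exists (W : {set T}) (v : T),
           [/\ #|W| = n - 1, complete_on k H W, v \notin W
             & free (P k l) (link H v)].
Proof.
have lk : l < k by lia.
have [n0 stab] := tight_cycle_stability hk lk.
exists (n0 + 2 * k) => n nbig dn; rewrite subn1.
have low : 'C(n.-1, k) + ex_num (k - 1) n.-1 (P k l) <=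
    ex_num k n (tight_cycle k l n).
  by apply: ex_num_tight_cycle_ge => //; lia.
split.
  apply/eqP; rewrite eqn_leq low andbT; apply/bigmax_leqP => H /andP[Hk Hfree].
  (* Stability speaks only of hypergraphs with at least the conjectured number of edges; smaller
     ones satisfy the bound trivially. *)
  have /orP[//|leH] := leq_total #|H| ('C(n.-1, k) + ex_num (k - 1) n.-1 (P k l)).
  have n0n : n0 <= n by lia.
  by have := stab 'I_n H; rewrite card_ord => /(_ n0n Hk Hfree leH)[].
move=> T H cT [Hk Hfree cH]; subst n.
have [||_ [v [Hv vfree]]] := stab T H _ Hk Hfree; first by lia.
  by rewrite cH.
exists [set~ v], v; split=> //; first by rewrite cardsC1.
by rewrite !inE eqxx.
Qed.
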